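(* Let $(\pi,X)$ be a covincular pattern. Then the number of $(\pi,X)$-hits in each $\tau\in S_n$ can be computed in $\Theta(n!)$ time, with implied constants not depending on $|\pi|$.
   Context: A permutation in $S_m$ is a word containing each of $1,\dots,m$ exactly once. A covincular pattern is a pair $(\pi,X)$ with $\pi\in S_k$ and $X\subseteq\{0,\dots,k\}$. A $(\pi,X)$-hit in $\tau\in S_n$ is a $k$-letter subsequence $a_1\cdots a_k$ of $\tau$ order-isomorphic to $\pi$ such that, writing $b_1<\dots<b_k$ for its letters sorted by value: for each $x\in X$ with $1\le x\le k-1$, $b_{x+1}=b_x+1$; if $0\in X$ then $b_1=1$; and if $k\in X$ then $b_k=n$. Model of computation: a word RAM in which each permutation of length at most $n$ (letters in fixed-width bit blocks) fits in a constant number of machine words, standard integer and bitwise operations, shifts and popcount take constant time, and hash tables keyed by such words support insertion and lookup in constant time. *)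

(* Defs.v *)
From HB Require Import structures.
From mathcomp Require Import all_boot all_order all_fingroup.

Set Implicit Arguments.
Unset Strict Implicit.
Unset Printing Implicit Defensive.

(** * Covincular patterns

    A permutation t : 'S_n is the word whose letter at position i is
    (t i).+1, so that letters range over 1, ..., n.  A subsequence of k letters
    is given by its increasing sequence of positions f. *)

Section Covincular.

Variables (k n : nat) (p : 'S_k) (X : {set 'I_k.+1}) (t : 'S_n).

Definition subseq_letter (f : {ffun 'I_k -> 'I_n}) (i : 'I_k) : nat :=
  (t (f i)).+1.

(* b_x, the x-th smallest letter of the subsequence, for 1 <= x <= k *)
Definition sorted_letter (f : {ffun 'I_k -> 'I_n}) (x : nat) : nat :=
  nth 0 (sort leq [seq subseq_letter f i | i <- enum 'I_k]) x.-1.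

Definition increasing_positions (f : {ffun 'I_k -> 'I_n}) : bool :=
  [forall i : 'I_k, forall j : 'I_k, (i < j) ==> (f i < f j)].

Definition order_isomorphic (f : {ffun 'I_k -> 'I_n}) : bool :=
  [forall i : 'I_k, forall j : 'I_k,
     (subseq_letter f i < subseq_letter f j) == (p i < p j)].

Definition adjacency_conditions (f : {ffun 'I_k -> 'I_n}) : bool :=
  [forall x in X,
     [&& (1 <= x < k) ==>
           (sorted_letter f x.+1 == (sorted_letter f x).+1),
         (x == 0 :> nat) ==> (sorted_letter f 1 == 1)
       & (x == k :> nat) ==> (sorted_letter f k == n)]].

Definition is_hit (f : {ffun 'I_k -> 'I_n}) : bool :=
  [&& increasing_positions f, order_isomorphic f & adjacency_conditions f].

Definition hits : nat := #|[set f : {ffun 'I_k -> 'I_n} | is_hit f]|.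

End Covincular.

(** * Word RAM with hash tables

    A word is a natural number below 2 ^ w.  Registers, memory cells and the
    values stored in hash tables are words; memory addresses are words; keys of
    hash tables are sequences of words, whose length is fixed by the text of
    the program.  Programs are written with structured control flow instead of
    jumps. *)

Definition reg := nat.

Inductive binop :=
  | Add | Sub | Mul | Div | Mod | And | Or | Xor | Shl | Shr | Lt | Eq.

Inductive unop := Not | Popcount.

Inductive cmd :=
  | Skip
  | Const of reg & nat
  | Un of unop & reg & reg
  | Bin of binop & reg & reg & reg
  | Read of reg & reg
  | Write of reg & reg
  | Insert of nat & seq reg & reg
  | Lookup of nat & seq reg & reg & reg
  | Seq of cmd & cmd
  | If of reg & cmd & cmd
  | While of reg & cmd.

Record state := State {
  regs : reg -> nat;
  mem : nat -> nat;
  tabs : nat -> seq nat -> option nat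
}.

Definition upd (A : eqType) (B : Type) (f : A -> B) (a : A) (b : B) : A -> B :=
  fun x => if x == a then b else f x.

Definition set_reg (s : state) (r : reg) (v : nat) : state :=
  State (upd (regs s) r v) (mem s) (tabs s).

Definition set_mem (s : state) (a v : nat) : state :=
  State (regs s) (upd (mem s) a v) (tabs s).

Definition set_tab (s : state) (h : nat) (key : seq nat) (v : nat) : state :=
  State (regs s) (mem s) (upd (tabs s) h (upd (tabs s h) key (Some v))).

Definition eval_unop (w : nat) (o : unop) (x : nat) : nat :=
  match o with
  | Not => 2 ^ w - 1 - x
  | Popcount => \sum_(i < w) Nat.testbit x i
  end.

(* All arithmetic is modulo 2 ^ w; comparisons return 0 or 1. *)
Definition eval_binop (w : nat) (o : binop) (x y : nat) : nat :=
  match o with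
  | Add => (x + y) %% 2 ^ w
  | Sub => (x + 2 ^ w - y) %% 2 ^ w
  | Mul => (x * y) %% 2 ^ w
  | Div => x %/ y
  | Mod => x %% y
  | And => Nat.land x y
  | Or => Nat.lor x y
  | Xor => Nat.lxor x y
  | Shl => (x * 2 ^ y) %% 2 ^ w
  | Shr => x %/ 2 ^ y
  | Lt => x < y
  | Eq => x == y
  end.

(* exec w c s T s' : on words of w bits, the program c started in state s halts
   in state s' after T steps; every basic instruction and every evaluation of
   the guard of a conditional or of a loop is one step.
   Lookup h ks f r sets f to 1 and r to the value found if the key is present in
   the table h, and sets both to 0 otherwise. *)
Inductive exec (w : nat) : cmd -> state -> nat -> state -> Prop :=
  | ExecSkip s : exec w Skip s 1 s
  | ExecConst s r c : exec w (Const r c) s 1 (set_reg s r (c %% 2 ^ w))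
  | ExecUn s o r a :
      exec w (Un o r a) s 1 (set_reg s r (eval_unop w o (regs s a)))
  | ExecBin s o r a b :
      exec w (Bin o r a b) s 1
        (set_reg s r (eval_binop w o (regs s a) (regs s b)))
  | ExecRead s r a : exec w (Read r a) s 1 (set_reg s r (mem s (regs s a)))
  | ExecWrite s a r : exec w (Write a r) s 1 (set_mem s (regs s a) (regs s r))
  | ExecInsert s h ks r :
      exec w (Insert h ks r) s 1
        (set_tab s h [seq regs s x | x <- ks] (regs s r))
  | ExecLookup s h ks f r :
      let res := tabs s h [seq regs s x | x <- ks] in
      exec w (Lookup h ks f r) s 1
        (set_reg (set_reg s f (isSome res)) r (odflt 0 res))
  | ExecSeq c1 c2 s1 s2 s3 T1 T2 :
      exec w c1 s1 T1 s2 -> exec w c2 s2 T2 s3 ->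
      exec w (Seq c1 c2) s1 (T1 + T2) s3
  | ExecIfTrue r c1 c2 s s' T :
      regs s r != 0 -> exec w c1 s T s' -> exec w (If r c1 c2) s T.+1 s'
  | ExecIfFalse r c1 c2 s s' T :
      regs s r = 0 -> exec w c2 s T s' -> exec w (If r c1 c2) s T.+1 s'
  | ExecWhileFalse r c s :
      regs s r = 0 -> exec w (While r c) s 1 s
  | ExecWhileTrue r c s1 s2 s3 T1 T2 :
      regs s1 r != 0 -> exec w c s1 T1 s2 -> exec w (While r c) s2 T2 s3 ->
      exec w (While r c) s1 (T1 + T2).+1 s3.

(** * Input and output *)

(* Permutations of length at most n fit in D words of w bits, with letters in
   blocks of b bits, w %/ b blocks per word.  The condition n < w, which follows
   from the others as soon as 2 ^ D <= n, ensures that the numbers of hits, at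
   most 2 ^ n, are words. *)
Definition perm_fits (D n b w : nat) : bool :=
  [&& n < 2 ^ b, b <= w, n <= D * (w %/ b) & n < w].

(* Word j holds the letters at positions i with i %/ (w %/ b) = j, the lower
   positions in the less significant blocks. *)
Definition encode_perm (D n b w : nat) (t : 'S_n) : seq nat :=
  [seq \sum_(i < n | i %/ (w %/ b) == j) (t i).+1 * 2 ^ (b * (i %% (w %/ b)))
     | j <- iota 0 D].

(* Initially registers 0, 1, 2, 3 hold n, k, b, w; the memory holds the k letters
   of p followed by the k + 1 bits of the characteristic vector of X; all other
   registers and cells are 0 and all hash tables are empty. *)
Definition input_mem (k : nat) (p : 'S_k) (X : {set 'I_k.+1}) : seq nat :=
  [seq (p i).+1 | i <- enum 'I_k] ++
  [seq nat_of_bool (x \in X) | x <- enum 'I_k.+1].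

Definition input_state (k : nat) (p : 'S_k) (X : {set 'I_k.+1}) (n b w : nat) :
    state :=
  State (nth 0 [:: n; k; b; w]) (nth 0 (input_mem p X)) (fun _ _ => None).

(* Hash table 0 is the output: it maps each t in S_n to its number of hits. *)
Definition outputs_hits (D k : nat) (p : 'S_k) (X : {set 'I_k.+1})
    (n b w : nat) (s : state) : Prop :=
  forall t : 'S_n, tabs s 0 (encode_perm D b w t) = Some (hits p X t).

(* Main.v *)
From Stdlib Require Import PeanoNat FunctionalExtensionality.
Require Import Defs.
From HB Require Import structures.
From mathcomp Require Import all_boot all_order all_fingroup.
From mathcomp Require Import zify.

Set Implicit Arguments.
Unset Strict Implicit.
Unset Printing Implicit Defensive.

(** Write a permutation t as the word of the positions of its letters, the largest
    letter first.  Let P_i(u) be the number of hits in the injective word u whose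
    i largest letters are the i largest letters of u; it vanishes unless the first
    i positions are ordered as the pattern prescribes, and otherwise
    P_i(u) = P_(i+1)(u) + [gap allowed] P_i(u without its entry of index i).
    Traversing all injective words by increasing length, and storing P_0(u) and the
    differences P_0(u) - P_i(u) in hash tables, every word costs time proportional
    to the length of its longest matching prefix.  Exchanging two consecutive
    matched entries destroys the match, so the number of words of given length that
    match up to i at least halves whenever i grows by two, and the cost per word is
    bounded on average.  There are at most 3 n! injective words.  Conversely, the
    output table has n! keys and each step inserts at most one of them. *)

(** * Bit masks *)

(** Positions are never renumbered. A word of any length keeps its positions below [n], and a
    position carries its letter counted from the end of the word, or 0 if it is absent. A suffix
    thus keeps its letters, and deleting an entry lowers by one exactly the letters in front of it.
    All keys needed while a word is scanned are therefore running sums of precomputed blocks,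
    updated in constant time.

    In the inverse word a condition on consecutive values is a condition on entries skipped between
    two chosen ones, which is why only the number of entries chosen so far matters for a gap.

    The differences P_0(u) - P_i(u) are stored because they grow by one summand per matched entry
    while u is scanned, whereas P_0(u), and with it every P_i(u), is known only when the scan ends.
    For an earlier word P_i is recovered by one subtraction.

    A permutation fills [D] machine words, hence the vector language, whose compiler unrolls each
    vector operation; the time constant depends on [D] alone. The loops over the pattern are run
    only if [k <= n], since otherwise there are no hits; this keeps [k] out of the bound. *)

Definition bitmask (s : seq nat) : nat := \sum_(a <- s) 2 ^ a.

Lemma bitmask_cons a s : bitmask (a :: s) = 2 ^ a + bitmask s.
Proof. by rewrite /bitmask big_cons. Qed.

Lemma bitmask_cat s1 s2 : bitmask (s1 ++ s2) = bitmask s1 + bitmask s2.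
Proof. by rewrite /bitmask big_cat. Qed.

Lemma bitmask_iota m : bitmask (iota 0 m) = 2 ^ m - 1.
Proof.
elim: m => [|m IH]; first by rewrite /bitmask big_nil.
rewrite -addn1 iotaD bitmask_cat IH add0n /= bitmask_cons /bitmask big_nil.
have := expn_gt0 2 m; rewrite addn1 expnS; lia.
Qed.

Lemma bitmask_perm s1 s2 : perm_eq s1 s2 -> bitmask s1 = bitmask s2.
Proof. exact: perm_big. Qed.

(** A duplicate-free list of exponents below [m] is completed to a permutation of all of them, whose
    mask is [2 ^ m - 1]. *)
Lemma bitmask_lt s m : uniq s -> all (ltn^~ m) s -> bitmask s < 2 ^ m.
Proof.
move=> us /allP as_; have : bitmask s <= bitmask (iota 0 m).
  rewrite (@bitmask_perm (iota 0 m) (s ++ [seq x <- iota 0 m | x \notin s])).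
    by rewrite bitmask_cat leq_addr.
  apply: uniq_perm; rewrite ?iota_uniq //.
    rewrite cat_uniq us filter_uniq ?iota_uniq // andbT.
    by apply/hasPn => x; rewrite mem_filter => /andP[].
  move=> x; rewrite mem_cat mem_filter mem_iota /= add0n.
  by case: (boolP (x \in s)) => // /as_.
by rewrite bitmask_iota; have := expn_gt0 2 m; lia.
Qed.

(** Exponents at least [e] contribute a multiple of [2 ^ e], the others together less than [2 ^ e].
    Reduction modulo a power of two thus restricts a set of positions to the smaller ones, and
    popcount then yields a rank. *)
Lemma bitmask_mod s e : uniq s ->
  bitmask s %% 2 ^ e = bitmask [seq a <- s | a < e].
Proof.
move=> us.
have dv : 2 ^ e %| bitmask [seq a <- s | ~~ (a < e)].
  rewrite /bitmask big_filter; elim/big_ind: _ => // [x y|i].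
    exact: dvdn_add.
  by rewrite -leqNgt => /(dvdn_exp2l 2).
rewrite (bitmask_perm (s2 := [seq a <- s | a < e] ++ [seq a <- s | ~~ (a < e)])).
  rewrite bitmask_cat -modnDmr (eqP dv) addn0 modn_small // bitmask_lt //.
    exact: filter_uniq.
  by apply/allP => x; rewrite mem_filter => /andP[].
by rewrite perm_sym perm_filterC.
Qed.

Lemma Nat_oddE x : Nat.odd x = odd x.
Proof.
have [m] := ubnP x; elim: m x => // m IH [|[|x]] // lt_x.
by rewrite /= negbK -IH // -ltnS ltnW.
Qed.

Lemma Nat_div2E x : Nat.div2 x = x %/ 2.
Proof. by rewrite divn2; have [m] := ubnP x; elim: m x => // m IH [|[|x]] // lt_x; rewrite /= IH // -ltnS ltnW. Qed.

Lemma testbitE x i : Nat.testbit x i = odd (x %/ 2 ^ i).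
Proof.
elim: i x => [|i IH] x; first by rewrite divn1 -Nat_oddE.
by rewrite -[LHS]/(Nat.testbit (Nat.div2 x) i) IH Nat_div2E -divnMA -expnS.
Qed.

Lemma bitmask_testbit s i : uniq s -> Nat.testbit (bitmask s) i = (i \in s).
Proof.
move=> us.
have low m : bitmask [seq a <- s | a < m] < 2 ^ m.
  rewrite bitmask_lt ?filter_uniq //.
  by apply/allP => x; rewrite mem_filter => /andP[].
have E : bitmask [seq a <- s | a < i.+1] =
         bitmask [seq a <- s | a < i] + (i \in s) * 2 ^ i.
  rewrite (@bitmask_perm [seq a <- s | a < i.+1]
     ([seq a <- s | a < i] ++ nseq (i \in s) i)).
    by rewrite bitmask_cat; case: (i \in s); rewrite /= ?mul1n ?mul0n /bitmask ?big_seq1 ?big_nil.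
  apply: uniq_perm; first exact: filter_uniq.
    rewrite cat_uniq filter_uniq //=; case: (i \in s) => //=.
    by rewrite mem_filter ltnn.
  move=> x; rewrite mem_filter mem_cat mem_filter ltnS leq_eqVlt.
  rewrite mem_nseq; case: eqP => [->|ne] /=; first by rewrite ltnn; case: (i \in s).
  by rewrite andbF orbF.
have : bitmask s %% 2 ^ i.+1 = bitmask [seq a <- s | a < i] + (i \in s) * 2 ^ i.
  by rewrite bitmask_mod.
rewrite (divn_eq (bitmask s) (2 ^ i.+1)) modnMDl modn_mod => ->.
set A := bitmask _ %/ _; have := low i; set B := bitmask _ => ltB.
have -> : A * 2 ^ i.+1 + (B + (i \in s) * 2 ^ i) = (A * 2 + (i \in s)) * 2 ^ i + B.
  by rewrite expnS; lia.
rewrite testbitE divnMDl ?expn_gt0 // divn_small // addn0 oddD oddM andbF /=.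
by case: (i \in s).
Qed.

Lemma popcount_bitmask w s : uniq s -> all (ltn^~ w) s ->
  eval_unop w Popcount (bitmask s) = size s.
Proof.
move=> us /allP as_ /=.
under eq_bigr do rewrite bitmask_testbit //.
rewrite -(big_mkord xpredT (fun i => nat_of_bool (i \in s))).
rewrite /index_iota subn0.
have -> : \sum_(i <- iota 0 w) (i \in s) = count (mem s) (iota 0 w).
  by rewrite -sum1_count [RHS]big_mkcond; apply: eq_bigr => i _ /=; case: (_ \in _).
rewrite -size_filter; apply: perm_size; apply: uniq_perm => //.
  by rewrite filter_uniq ?iota_uniq.
move=> x; rewrite mem_filter mem_iota /= add0n.
by case: (boolP (x \in s)) => [/as_ /= ->|].
Qed.

(** Subtracting one replaces the lowest bit [a] by the [a] bits below it. The machine has no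
    instruction for the index of the lowest bit; two popcounts supply it. *)
Lemma lowest_bit w a s : uniq (a :: s) -> all (ltn^~ w) (a :: s) ->
  all (ltn a) s ->
  eval_unop w Popcount (bitmask (a :: s) - 1) + 1 =
    a + eval_unop w Popcount (bitmask (a :: s)).
Proof.
move=> uas alls /allP lts; rewrite popcount_bitmask //.
have /andP[_ us] := etrans (esym (cons_uniq _ _)) uas.
have /andP[lta /allP ltw] : (a < w) && all (ltn^~ w) s by [].
have -> : bitmask (a :: s) - 1 = bitmask (iota 0 a ++ s).
  by rewrite bitmask_cons bitmask_cat bitmask_iota; have := expn_gt0 2 a; lia.
rewrite popcount_bitmask ?size_cat ?size_iota /=; first by lia.
  rewrite cat_uniq iota_uniq us /= andbT; apply/hasPn => x /lts /=.
  by rewrite mem_iota /=; lia.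
rewrite all_cat; apply/andP; split; apply/allP => x; last exact: ltw.
by rewrite mem_iota /=; lia.
Qed.

(** * A vector language on top of the word RAM *)

(* Scalar registers are numbered below 32; coordinate j of vector v < 8 is
   register vreg v j.  Vector instructions act on all D coordinates, coordinate
   j of a vector table h being the hash table h + 2 * j. *)
Definition vreg (v j : nat) : reg := 32 + (8 * j + v).

Inductive operand := Scal of nat | Vect of nat.

(* VHot v t x puts the value of x at the coordinate of v given by t, and 0 at the
   others; it destroys t, x and register 31.  It counts t down because the index
   of a coordinate need not be a word. *)
Inductive hcmd :=
  | HConst of nat & nat
  | HUn of unop & nat & nat
  | HBin of binop & nat & nat & nat
  | HRead of nat & nat
  | HInsert of nat & seq operand & nat
  | HLookup of nat & seq operand & nat & nat
  | VBin of binop & nat & operand & operand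
  | VLookup of nat & seq operand & nat & nat
  | VInsert of nat & seq operand & nat
  | VHot of nat & nat & nat
  | HSeq of hcmd & hcmd
  | HIf of nat & hcmd & hcmd
  | HWhile of nat & hcmd.

Record hstate := HState {
  sc : nat -> nat;
  ve : nat -> nat -> nat;
  me : nat -> nat;
  ta : nat -> seq nat -> option nat
}.

Definition conc (s : hstate) : state :=
  State (fun r => if r < 32 then sc s r
                  else ve s ((r - 32) %% 8) ((r - 32) %/ 8)) (me s) (ta s).

Definition set_sc s r x := HState (upd (sc s) r x) (ve s) (me s) (ta s).
Definition set_ve s f := HState (sc s) f (me s) (ta s).
Definition set_ta s f := HState (sc s) (ve s) (me s) f.

Fixpoint vfor (d : nat) (c : nat -> cmd) : cmd :=
  if d is d'.+1 then Seq (vfor d' c) (c d') else Skip.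

Section VectorLanguage.

Variables (D w : nat).

Definition opreg (j : nat) (o : operand) : reg :=
  match o with Scal r => r | Vect v => vreg v j end.

Definition keyregs (ks : seq operand) : seq reg :=
  flatten [seq match o with
               | Scal r => [:: r]
               | Vect v => mkseq (vreg v) D
               end | o <- ks].

Fixpoint comp (c : hcmd) : cmd :=
  match c with
  | HConst r x => Const r x
  | HUn o r a => Un o r a
  | HBin o r a b => Bin o r a b
  | HRead r a => Read r a
  | HInsert h ks r => Insert h (keyregs ks) r
  | HLookup h ks f r => Lookup h (keyregs ks) f r
  | VBin o v a b => vfor D (fun j => Bin o (vreg v j) (opreg j a) (opreg j b))
  | VLookup h ks f v =>
      vfor D (fun j => Lookup (h + 2 * j) (keyregs ks) f (vreg v j))
  | VInsert h ks v =>
      vfor D (fun j => Insert (h + 2 * j) (keyregs ks) (vreg v j))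
  | VHot v t x =>
      Seq (Const 31 1)
        (vfor D (fun j => If t (Seq (Bin Defs.Sub t t 31) (Const (vreg v j) 0))
                               (Seq (Bin Or (vreg v j) x x) (Const x 0))))
  | HSeq c1 c2 => Seq (comp c1) (comp c2)
  | HIf r c1 c2 => If r (comp c1) (comp c2)
  | HWhile r c => While r (comp c)
  end.

Definition opval (s : hstate) (j : nat) (o : operand) : nat :=
  match o with Scal r => sc s r | Vect v => ve s v j end.

Definition vec (s : hstate) (v : nat) : seq nat := mkseq (ve s v) D.

Definition keyval (s : hstate) (ks : seq operand) : seq nat :=
  flatten [seq match o with Scal r => [:: sc s r] | Vect v => vec s v end
          | o <- ks].

Definition vupd (f : nat -> nat -> nat) (v d : nat) (g : nat -> nat) :=
  fun v' j => if (v' == v) && (j < d) then g j else f v' j.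

Definition tupd (f : nat -> seq nat -> option nat) (h : nat) (key : seq nat)
    (d : nat) (g : nat -> nat) :=
  fun h' key' =>
    if [&& h <= h', ~~ odd (h' - h), (h' - h)./2 < d & key' == key]
    then Some (g (h' - h)./2) else f h' key'.

(** The values at [VHot] and [HWhile] are dummies, as [loop_free] excludes both: the effect of the
    first is known only if its counter is a word, and the second requires an invariant. *)
Fixpoint hsem (c : hcmd) (s : hstate) : hstate :=
  match c with
  | HConst r x => set_sc s r (x %% 2 ^ w)
  | HUn o r a => set_sc s r (eval_unop w o (sc s a))
  | HBin o r a b => set_sc s r (eval_binop w o (sc s a) (sc s b))
  | HRead r a => set_sc s r (me s (sc s a))
  | HInsert h ks r =>
      set_ta s (upd (ta s) h (upd (ta s h) (keyval s ks) (Some (sc s r))))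
  | HLookup h ks f r =>
      let res := ta s h (keyval s ks) in
      set_sc (set_sc s f (isSome res)) r (odflt 0 res)
  | VBin o v a b =>
      set_ve s (vupd (ve s) v D
        (fun j => eval_binop w o (opval s j a) (opval s j b)))
  | VLookup h ks f v =>
      set_sc
       (set_ve s (vupd (ve s) v D
         (fun j => odflt 0 (ta s (h + 2 * j) (keyval s ks)))))
       f (isSome (ta s (h + 2 * D.-1) (keyval s ks)))
  | VInsert h ks v => set_ta s (tupd (ta s) h (keyval s ks) D (ve s v))
  | HSeq c1 c2 => hsem c2 (hsem c1 s)
  | HIf r c1 c2 => if sc s r != 0 then hsem c1 s else hsem c2 s
  | VHot _ _ _ | HWhile _ _ => s
  end.

Definition wf_op (o : operand) : bool :=
  match o with Scal r => r < 32 | Vect v => v < 8 end.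

(** A vector lookup evaluates its key anew for every coordinate, while the flag and the target are
    already being overwritten. Neither may occur in the key. *)
Definition fresh_op (f v : nat) (o : operand) : bool :=
  match o with Scal r => r != f | Vect u => u != v end.

Fixpoint loop_free (c : hcmd) : bool :=
  match c with
  | HConst r _ => r < 32
  | HUn _ r a => (r < 32) && (a < 32)
  | HBin _ r a b => [&& r < 32, a < 32 & b < 32]
  | HRead r a => (r < 32) && (a < 32)
  | HInsert _ ks r => all wf_op ks && (r < 32)
  | HLookup _ ks f r => [&& all wf_op ks, f < 32 & r < 32]
  | VBin _ v a b => [&& v < 8, wf_op a & wf_op b]
  | VLookup _ ks f v => [&& all wf_op ks, all (fresh_op f v) ks, f < 32 & v < 8]
  | VInsert _ ks v => all wf_op ks && (v < 8)
  | HSeq c1 c2 => loop_free c1 && loop_free c2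
  | HIf r c1 c2 => [&& r < 32, loop_free c1 & loop_free c2]
  | VHot _ _ _ | HWhile _ _ => false
  end.

(** An upper bound on the number of steps: a conditional is charged for both branches, which only
    affects constants. *)
Fixpoint hsize (c : hcmd) : nat :=
  match c with
  | VBin _ _ _ _ | VLookup _ _ _ _ | VInsert _ _ _ => D.+1
  | HSeq c1 c2 => hsize c1 + hsize c2
  | HIf _ c1 c2 => (hsize c1 + hsize c2).+1
  | _ => 1
  end.

(** * Simulation of the vector language by the word RAM *)

Lemma set_reg_sc s r x : r < 32 -> set_reg (conc s) r x = conc (set_sc s r x).
Proof.
move=> lt_r; rewrite /set_reg /conc /=; congr State.
apply: functional_extensionality => r'; rewrite /upd.
by case: eqP => [->|]; rewrite ?lt_r.
Qed.

Lemma set_reg_ve s v j x : v < 8 ->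
  set_reg (conc s) (vreg v j) x =
  conc (set_ve s (fun v' j' => if (v' == v) && (j' == j) then x else ve s v' j')).
Proof.
move=> lt_v; rewrite /set_reg /conc /=; congr State.
apply: functional_extensionality => r; rewrite /upd /vreg.
case: eqP => [->|ne].
  rewrite ltnNge leq_addr /= addKn mulnC modnMDl modn_small //.
  by rewrite divnMDl // divn_small // addn0 !eqxx.
case: ltnP => // le32; case: ifP => // /andP[/eqP Ev /eqP Ej].
by case: ne; rewrite -Ev -Ej mulnC -divn_eq subnKC.
Qed.

Lemma conc_sc s r : r < 32 -> regs (conc s) r = sc s r.
Proof. by move=> /= ->. Qed.

Lemma conc_ve s v j : v < 8 -> regs (conc s) (vreg v j) = ve s v j.
Proof.
move=> lt_v; rewrite -[LHS]/(if vreg v j < 32 then sc s (vreg v j) else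
  ve s ((vreg v j - 32) %% 8) ((vreg v j - 32) %/ 8)) /vreg ltnNge leq_addr.
by rewrite addKn mulnC modnMDl modn_small // divnMDl // divn_small // addn0.
Qed.

Lemma conc_op s j o : wf_op o -> regs (conc s) (opreg j o) = opval s j o.
Proof. by case: o => [r|v] lt; [apply: conc_sc | apply: conc_ve]. Qed.

Lemma conc_key s ks : all wf_op ks ->
  [seq regs (conc s) x | x <- keyregs ks] = keyval s ks.
Proof.
elim: ks => //= o ks IH /andP[wo wks].
rewrite -[keyregs _]/(_ ++ keyregs ks) map_cat IH //.
rewrite -[keyval _ (_ :: _)]/(_ ++ keyval s ks); congr (_ ++ _).
case: o wo => [r|v] lt; first by rewrite /= (lt : r < 32).
by rewrite /vec /mkseq -map_comp; apply: eq_map => j; exact: conc_ve.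
Qed.

Lemma exec_vfor (c : nat -> cmd) (st : nat -> hstate) d N :
  (forall j, j < d ->
     exists2 T, T <= N & exec w (c j) (conc (st j)) T (conc (st j.+1))) ->
  exists2 T, T <= N * d + 1 & exec w (vfor d c) (conc (st 0)) T (conc (st d)).
Proof.
elim: d => [|d IH] H /=; first by exists 1; rewrite ?muln0 //; apply: ExecSkip.
have [T1 le1 E1] := IH (fun j lt => H j (leqW lt)).
have [T2 le2 E2] := H d (ltnSn d).
by exists (T1 + T2); [rewrite mulnS; lia | apply: ExecSeq E1 E2].
Qed.

Definition steps (c : hcmd) (s : hstate) (N : nat) (s' : hstate) : Prop :=
  exists2 T, T <= N & exec w (comp c) (conc s) T (conc s').

Definition op_agree (s s' : hstate) (o : operand) : Prop :=
  match o with Scal r => sc s r = sc s' r | Vect v => vec s v = vec s' v end.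

Lemma keyval_fresh s s' f v ks :
  (forall o, fresh_op f v o -> op_agree s s' o) ->
  all (fresh_op f v) ks -> keyval s ks = keyval s' ks.
Proof.
rewrite /keyval => H; elim: ks => //= o ks IH /andP[/H + /IH->].
by case: o => [r|u] /= ->.
Qed.

Lemma vec_vupd_neq s f v d g v' : v' != v ->
  vec (set_ve s (vupd f v d g)) v' = mkseq (f v') D.
Proof. by move=> /negPf ne; apply: eq_map => j; rewrite /= /vupd ne. Qed.

Lemma vupd0 f v g : vupd f v 0 g = f.
Proof.
by do 2!apply: functional_extensionality => ?; rewrite /vupd ltn0 andbF.
Qed.

Lemma vupdS f v d g : vupd f v d.+1 g =
  (fun v' j => if (v' == v) && (j == d) then g d else vupd f v d g v' j).
Proof.
apply: functional_extensionality => v'; apply: functional_extensionality => j.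
rewrite /vupd ltnS [j <= d]leq_eqVlt; case: (v' =P v) => //= _.
by case: eqP => [->|].
Qed.

Lemma steps_vbin o v a b s : loop_free (VBin o v a b) ->
  steps (VBin o v a b) s D.+1 (hsem (VBin o v a b) s).
Proof.
move=> /= /and3P[lt_v wa wb].
pose st d := set_ve s (vupd (ve s) v d
        (fun j => eval_binop w o (opval s j a) (opval s j b))).
have := @exec_vfor (fun j => Bin o (vreg v j) (opreg j a) (opreg j b)) st D 1.
case=> [j ltj|T].
  exists 1 => //.
  have := ExecBin w (conc (st j)) o (vreg v j) (opreg j a) (opreg j b).
  rewrite !conc_op // set_reg_ve //.
  set s1 := set_ve _ _; suff -> : s1 = st j.+1 by [].
  rewrite /s1 /st /set_ve /=.
  rewrite vupdS; congr HState; do 2!apply: functional_extensionality => ?.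
  (* Coordinate [j] is read before it is written and no other coordinate is read, so the target may
     occur among the operands. *)
  by case: (a) (b) => [?|?] [?|?] //=; rewrite /vupd ltnn ?andbF.
rewrite mul1n addn1 => leT; rewrite /st vupd0.
by case: (s) => *; exists T.
Qed.

Lemma steps_vlookup h ks f v s : 0 < D -> loop_free (VLookup h ks f v) ->
  steps (VLookup h ks f v) s D.+1 (hsem (VLookup h ks f v) s).
Proof.
move=> D_gt0 /= /and4P[wks fks lt_f lt_v].
pose res j := ta s (h + 2 * j) (keyval s ks).
pose st d := HState (if d is d'.+1 then upd (sc s) f (nat_of_bool (isSome (res d')))
                     else sc s)
                    (vupd (ve s) v d (fun j => odflt 0 (res j))) (me s) (ta s).
have := @exec_vfor (fun j => Lookup (h + 2 * j) (keyregs ks) f (vreg v j)) st D 1.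
case=> [j ltj|T].
  exists 1 => //.
  have := ExecLookup w (conc (st j)) (h + 2 * j) (keyregs ks) f (vreg v j).
  have -> : [seq regs (conc (st j)) x | x <- keyregs ks] = keyval s ks.
    rewrite conc_key //; apply: keyval_fresh fks => -[r|u] /= ne.
      by case: (j) => //= ?; rewrite /upd (negPf ne).
    exact: (vec_vupd_neq s).
  rewrite -[tabs _ _ _]/(res j) /= set_reg_sc // set_reg_ve //.
  set s1 := set_ve _ _; suff -> : s1 = st j.+1 by [].
  rewrite /s1 /st /set_ve /set_sc /=; congr HState.
    apply: functional_extensionality => r; rewrite /upd.
    by case: (j) => [|?]; case: eqP.
  by rewrite vupdS.
rewrite mul1n addn1 => leT; rewrite {1}/st vupd0.
set s1 := HState _ _ _ _; have -> : s1 = s by rewrite /s1; case: (s).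
set s2 := set_sc _ _ _; have -> : st D = s2.
  by rewrite /st /s2 /set_sc /=; congr HState; case: (D) D_gt0.
by exists T.
Qed.

Lemma steps_vinsert h ks v s : loop_free (VInsert h ks v) ->
  steps (VInsert h ks v) s D.+1 (hsem (VInsert h ks v) s).
Proof.
move=> /= /andP[wks lt_v].
pose st d := set_ta s (tupd (ta s) h (keyval s ks) d (ve s v)).
have := @exec_vfor (fun j => Insert (h + 2 * j) (keyregs ks) (vreg v j)) st D 1.
case=> [j ltj|T].
  exists 1 => //.
  have := ExecInsert w (conc (st j)) (h + 2 * j) (keyregs ks) (vreg v j).
  rewrite conc_key // conc_ve //.
  set s1 := set_tab _ _ _ _; suff -> : s1 = conc (st j.+1) by [].
  rewrite /s1 /st /conc /set_tab /=; congr State.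
  apply: functional_extensionality => h'; apply: functional_extensionality => key.
  rewrite /upd /tupd ltnS -[keyval (set_ta _ _) ks]/(keyval s ks).
  case: (h' =P _) => [->|ne].
    rewrite leq_addr addKn mul2n odd_double doubleK leqnn ltnn.
    by case: eqP.
  case: (leqP h h') => //= le_h; case: (boolP (odd _)) => //= ev.
  rewrite [(h' - h)./2 <= j]leq_eqVlt; case: (_ =P j) => //= Ej; case: ne; rewrite -Ej.
  by have := odd_double_half (h' - h); rewrite (negPf ev); lia.
rewrite mul1n addn1 => leT.
have -> : st 0 = s.
  rewrite /st /set_ta; case: (s) => ? ? ? t /=; congr HState.
  do 2!apply: functional_extensionality => ?.
  by rewrite /tupd ltn0 /= !andbF.
by exists T.
Qed.

Definition hot_state s v t x :=
  HState (upd (upd (upd (sc s) 31 1) t (sc s t - D)) x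
              (if sc s t < D then 0 else sc s x))
         (vupd (ve s) v D (fun j => (j == sc s t) * sc s x)) (me s) (ta s).

(** After [d] coordinates the counter is the truncated difference [T - d]. It is zero from
    coordinate [T] on, and the value is stored there and cleared at once, so that all later
    coordinates receive 0. *)
Lemma steps_vhot v t x s : 0 < w -> t < 31 -> x < 31 -> t != x -> v < 8 ->
  sc s t < 2 ^ w -> steps (VHot v t x) s (3 * D + 2) (hot_state s v t x).
Proof.
move=> w_gt0 lt_t lt_x ne lt_v lt_tw.
have lt_t' : t < 32 by exact: ltnW. have lt_x' : x < 32 by exact: ltnW.
set T := sc s t; set X := sc s x.
pose st d := HState (upd (upd (upd (sc s) 31 1) t (T - d)) x (if T < d then 0 else X))
         (vupd (ve s) v d (fun j => (j == T) * X)) (me s) (ta s).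
pose c j := If t (Seq (Bin Defs.Sub t t 31) (Const (vreg v j) 0))
                 (Seq (Bin Or (vreg v j) x x) (Const x 0)).
have step j : j < D ->
  exists2 T, T <= 3 & exec w (c j) (conc (st j)) T (conc (st j.+1)).
  move=> ltj; exists 3 => //.
  have Et : regs (conc (st j)) t = T - j.
    by rewrite conc_sc //= /upd eqxx (negPf ne).
  case: (posnP (T - j)) => Tj.
    apply: ExecIfFalse; first by rewrite Et.
    apply: (@ExecSeq _ _ _ _ _ _ 1 1); first exact: ExecBin.
    rewrite conc_sc // set_reg_ve //.
    set s1 := conc (set_ve _ _); have := ExecConst w s1 x 0.
    rewrite set_reg_sc //; set s2 := set_sc _ _ _.
    suff -> : s2 = st j.+1 by [].
    rewrite /s2 /st /set_sc /=; congr HState.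
      apply: functional_extensionality => r; rewrite /upd mod0n.
      case: eqP => [_|_]; first by rewrite ifT //; lia.
      by case: eqP => // _; lia.
    rewrite vupdS /upd eqxx Nat.lor_diag; do 2!apply: functional_extensionality => ?.
    by case: ifP => // _; case: ltngtP => lt; rewrite ?mul0n ?mul1n //; lia.
  apply: ExecIfTrue; first by rewrite Et -lt0n.
  apply: (@ExecSeq _ _ _ _ _ _ 1 1); first exact: ExecBin.
  rewrite Et set_reg_sc //.
  have -> : eval_binop w Defs.Sub (T - j) (regs (conc (st j)) 31) = T - j.+1.
    rewrite conc_sc //= /upd.
    rewrite !ifN //; [|by rewrite eq_sym ltn_eqF // |by rewrite eq_sym ltn_eqF //].
    have lt2 : T - j.+1 < 2 ^ w by apply: leq_ltn_trans lt_tw; rewrite leq_subr.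
    have -> : T - j + 2 ^ w - 1 = T - j.+1 + 2 ^ w by lia.
    by rewrite modnDr modn_small.
  set s1 := set_sc _ _ _; have := ExecConst w (conc s1) (vreg v j) 0.
  rewrite set_reg_ve //; set s2 := set_ve _ _.
  suff -> : s2 = st j.+1 by [].
  rewrite /s2 /s1 /st /set_sc /set_ve /=; congr HState.
    apply: functional_extensionality => r; rewrite /upd.
    case: (r =P t) => [->|//]; first by rewrite (negPf ne).
    by case: eqP => // _; rewrite !ifN //; lia.
  rewrite vupdS mod0n; do 2!apply: functional_extensionality => ?.
  by case: ifP => // _; rewrite ltn_eqF //; lia.
have [T' leT E] := exec_vfor step.
exists (1 + T'); first by lia.
apply: ExecSeq; first exact: ExecConst.
rewrite set_reg_sc //; set s1 := set_sc _ _ _; suff -> : s1 = st 0 by [].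
rewrite /s1 /st /set_sc vupd0; congr HState.
apply: functional_extensionality => r; rewrite /upd modn_small.
  rewrite ltn0 subn0; case: (r =P x) => [->|_]; first by rewrite (ltn_eqF lt_x).
  by case: (r =P t) => [->|//]; rewrite (ltn_eqF lt_t).
by rewrite -{1}(expn0 2) ltn_exp2l.
Qed.

Lemma steps_hsem c s : 0 < D -> loop_free c -> steps c s (hsize c) (hsem c s).
Proof.
move=> D_gt0.
elim: c s => //=; try by [move=> *; exact: steps_vbin | move=> *; exact: steps_vlookup
  | move=> *; exact: steps_vinsert].
- move=> r x s lt; exists 1 => //.
  by have := ExecConst w (conc s) r x; rewrite set_reg_sc.
- move=> o r a s /andP[ltr lta]; exists 1 => //.
  by have := ExecUn w (conc s) o r a; rewrite set_reg_sc // conc_sc.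
- move=> o r a b s /and3P[ltr lta ltb]; exists 1 => //.
  by have := ExecBin w (conc s) o r a b; rewrite set_reg_sc // !conc_sc.
- move=> r a s /andP[ltr lta]; exists 1 => //.
  by have := ExecRead w (conc s) r a; rewrite set_reg_sc // conc_sc.
- move=> h ks r s /andP[wks ltr]; exists 1 => //.
  by have := ExecInsert w (conc s) h (keyregs ks) r; rewrite conc_key // conc_sc.
- move=> h ks f r s /and3P[wks ltf ltr]; exists 1 => //.
  by have := ExecLookup w (conc s) h (keyregs ks) f r; rewrite conc_key //;
    cbv zeta; rewrite !set_reg_sc.
- move=> c1 IH1 c2 IH2 s /andP[lf1 lf2].
  have [T1 le1 E1] := IH1 s lf1; have [T2 le2 E2] := IH2 (hsem c1 s) lf2.
  by exists (T1 + T2); [rewrite leq_add | apply: ExecSeq E1 E2].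
- move=> r c1 IH1 c2 IH2 s /and3P[ltr lf1 lf2].
  have [T1 le1 E1] := IH1 s lf1; have [T2 le2 E2] := IH2 s lf2.
  case: eqP => /= [E0|/eqP ne].
    by exists T2.+1; [lia | apply: ExecIfFalse E2; rewrite conc_sc].
  by exists T1.+1; [lia | apply: ExecIfTrue E1; rewrite conc_sc].
Qed.

(** * Program triples with bounds on the number of steps *)

Definition hoare (c : hcmd) (s : hstate) (N : nat) (Q : hstate -> Prop) : Prop :=
  exists2 s', steps c s N s' & Q s'.

Lemma hoare_hsem c s N (Q : hstate -> Prop) :
  0 < D -> loop_free c -> hsize c <= N -> Q (hsem c s) -> hoare c s N Q.
Proof.
move=> D_gt0 lf le_N HQ; exists (hsem c s) => //.
by have [T leT E] := steps_hsem s D_gt0 lf; exists T => //; apply: leq_trans le_N.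
Qed.

Lemma hoare_seq c1 c2 s N1 N2 (Q : hstate -> Prop) :
  hoare c1 s N1 (fun s' => hoare c2 s' N2 Q) -> hoare (HSeq c1 c2) s (N1 + N2) Q.
Proof.
move=> [s1 [T1 le1 E1] [s2 [T2 le2 E2] HQ]]; exists s2 => //.
by exists (T1 + T2); [rewrite leq_add | apply: ExecSeq E1 E2].
Qed.

Lemma hoare_if r c1 c2 s N (Q : hstate -> Prop) : r < 32 ->
  (sc s r != 0 -> hoare c1 s N Q) -> (sc s r = 0 -> hoare c2 s N Q) ->
  hoare (HIf r c1 c2) s N.+1 Q.
Proof.
move=> ltr H1 H2; case: (eqVneq (sc s r) 0) => [E0|ne].
  have [s' [T le E] HQ] := H2 E0; exists s' => //; exists T.+1 => //.
  by apply: ExecIfFalse E; rewrite conc_sc.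
have [s' [T le E] HQ] := H1 ne; exists s' => //; exists T.+1 => //.
by apply: ExecIfTrue E; rewrite conc_sc.
Qed.

Lemma hoare_conseq c s N N' (Q Q' : hstate -> Prop) :
  hoare c s N Q -> N <= N' -> (forall s', Q s' -> Q' s') -> hoare c s N' Q'.
Proof.
move=> [s' [T le E] HQ] leN HQQ; exists s'; last exact: HQQ.
by exists T => //; apply: leq_trans leN.
Qed.

(** The invariant is indexed by the number of completed rounds and each round has its own cost
    [B i], because a round of the main loop is cheap only on average. *)
Lemma hoare_while r c (P : nat -> hstate -> Prop) N (B : nat -> nat) s : r < 32 ->
  (forall i s, i < N -> P i s -> sc s r != 0 /\ hoare c s (B i) (P i.+1)) ->
  (forall s, P N s -> sc s r = 0) -> P 0 s ->
  hoare (HWhile r c) s (\sum_(i < N) (B i).+1 + 1) (P N).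
Proof.
move=> ltr step stop P0.
suff H i s' : i <= N -> P i s' ->
    hoare (HWhile r c) s' (\sum_(i <= j < N) (B j).+1 + 1) (P N).
  by have := H 0 s (leq0n _) P0; rewrite big_mkord.
have [m] := ubnP (N - i); elim: m i s' => // m IH i s' lt_m le_i Pi.
case: (ltngtP i N) le_i => // [lt_i _|Ei _].
  have [ne [s1 [T1 le1 E1] P1]] := step i s' lt_i Pi.
  have [|s2 [T2 le2 E2] P2] := IH i.+1 s1 _ lt_i P1; first by lia.
  exists s2 => //; exists (T1 + T2).+1; last first.
    by apply: ExecWhileTrue E1 E2; rewrite conc_sc.
  by rewrite big_ltn //; lia.
exists s'; last by rewrite -Ei.
exists 1; first by lia.
by apply: ExecWhileFalse; rewrite conc_sc // stop // -Ei.
Qed.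

End VectorLanguage.

(** * Injective words in breadth-first order *)

Section Words.

Variable n : nat.

Definition is_word (u : seq nat) : bool := uniq u && all (ltn^~ n) u.

Definition avail (u : seq nat) : seq nat := [seq a <- iota 0 n | a \notin u].

Definition children (u : seq nat) : seq (seq nat) := [seq a :: u | a <- avail u].

Fixpoint level (m : nat) : seq (seq nat) :=
  if m is m'.+1 then flatten [seq children u | u <- level m'] else [:: [::]].

Definition words : seq (seq nat) := flatten [seq level m | m <- iota 0 n.+1].

Lemma avail_uniq u : uniq (avail u).
Proof. by rewrite filter_uniq ?iota_uniq. Qed.

Lemma mem_avail u a : (a \in avail u) = (a < n) && (a \notin u).
Proof. by rewrite mem_filter mem_iota andbC. Qed.

Lemma size_word u : is_word u -> size u <= n.
Proof.
move=> /andP[uu /allP lt_u]; rewrite -[leqRHS](size_iota 0); apply: uniq_leq_size => // a.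
by move/lt_u; rewrite mem_iota.
Qed.

Lemma size_avail u : is_word u -> size (avail u) = n - size u.
Proof.
move=> /andP[uu /allP lt_u].
have <- : size (iota 0 n) = n by rewrite size_iota.
rewrite -(count_predC (mem u) (iota 0 n)) size_filter.
rewrite (_ : count (mem u) (iota 0 n) = size u) ?addKn //.
rewrite -size_filter; apply: perm_size; apply: uniq_perm => //.
  by rewrite filter_uniq ?iota_uniq.
move=> a; rewrite mem_filter mem_iota /= add0n.
by case: (boolP (a \in u)) => [/lt_u|].
Qed.

Lemma mem_level m u : (u \in level m) = (size u == m) && is_word u.
Proof.
elim: m u => [|m IH] [|a u] /=; rewrite ?inE //.
  by apply/flatten_mapP => -[v _ /mapP[]].
rewrite eqSS /is_word /= -andbA; apply/flatten_mapP/idP => [[v]|].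
  rewrite IH => /andP[sv /andP[uv av]] /mapP[b]; rewrite mem_avail => /andP[lb nb] [-> ->].
  by rewrite nb sv lb uv av.
move=> /and5P[su na uu la au]; exists u; first by rewrite IH su /is_word uu.
by apply/mapP; exists a => //; rewrite mem_avail la.
Qed.

Lemma level_uniq m : uniq (level m).
Proof.
elim: m => // m IH; rewrite /=.
elim: (level m) IH => //= u us IHu /andP[nu /IHu uus].
rewrite cat_uniq uus andbT map_inj_uniq ?avail_uniq /=; last by move=> a b [].
apply/hasPn => v /flatten_mapP[u' u'us /mapP[a _ ->]].
by apply/mapP => -[b _ [_ E]]; move: nu; rewrite -E u'us.
Qed.

Lemma size_levelS m : size (level m.+1) = (n - m) * size (level m).
Proof.
rewrite /= size_flatten /shape -map_comp sumnE big_map big_seq.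
under eq_bigr => u.
  rewrite mem_level => /andP[/eqP su wu].
  rewrite /= size_map size_avail // su; over.
by rewrite -big_seq big_const_seq count_predT iter_addn_0.
Qed.

Lemma size_level_fact m : m <= n -> size (level m) * (n - m)`! = n`!.
Proof.
elim: m => [|m IH] le_m; first by rewrite mul1n subn0.
rewrite -(IH (ltnW le_m)) size_levelS -(subnSK le_m) factS; lia.
Qed.

(** As long as two positions remain available, adding an entry at least doubles the number of words,
    so the sum is dominated by a geometric series. *)
Lemma size_levels_le m : m < n ->
  \sum_(i < m.+1) size (level i) <= 2 * size (level m).
Proof.
elim: m => [|m IH] lt_m; first by rewrite big_ord1.
rewrite big_ord_recr /= -[flatten _]/(level m.+1) size_levelS.
have := IH (ltnW lt_m); have : 2 <= n - m by lia.
move: (size (level m)) (\sum_(_ < _) _) (n - m) => a b d; nia.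
Qed.

Lemma level_top : level n.+1 = [::].
Proof. by apply: size0nil; rewrite size_levelS subnn. Qed.

(** For [n > 0], the levels [n] and [n.-1] both have [n!] words. The levels up to [n.-1] contribute
    at most twice that and level [n] once more, whence the factor 3. *)
Lemma sum_size_levels : \sum_(i < n.+1) size (level i) <= 3 * n`!.
Proof.
have := size_level_fact (leqnn n); rewrite subnn fact0 muln1 => <-.
case: (posnP n) => [->|n_gt0]; first by rewrite big_ord1.
rewrite big_ord_recr /=.
have En := prednK n_gt0.
have Es : size (level n.-1.+1) = size (level n.-1).
  by rewrite size_levelS; have -> : n - n.-1 = 1 by [lia]; rewrite mul1n.
have := @size_levels_le n.-1; rewrite !En in Es *; rewrite leqnn => /(_ isT).
by rewrite -Es => H; rewrite mulSnr leq_add2r.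
Qed.

Lemma mem_words u : (u \in words) = is_word u.
Proof.
apply/flatten_mapP/idP => [[m _]|wu]; first by rewrite mem_level => /andP[].
exists (size u); last by rewrite mem_level eqxx.
by rewrite mem_iota /= ltnS size_word.
Qed.

Lemma words_before m1 m2 u : u \in flatten [seq level m | m <- iota m1 m2] ->
  m1 <= size u < m1 + m2.
Proof.
move=> /flatten_mapP[m]; rewrite mem_iota => lt_m.
by rewrite mem_level => /andP[/eqP->].
Qed.

Lemma words_uniq : uniq words.
Proof.
rewrite /words; move: n.+1 {1}0 => m m1; elim: m m1 => //= m IH m1.
rewrite cat_uniq level_uniq IH andbT /=; apply/hasPn => u /words_before.
by rewrite mem_level; case: eqP => // -> ; rewrite ltnn.
Qed.

(** Appending the children of each word in turn to the empty word reproduces the same list: [words]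
    is its own breadth-first queue. *)
Lemma words_eq : words = [::] :: flatten [seq children u | u <- words].
Proof.
rewrite /words -[n.+1]addn1 iotaD add0n map_cat flatten_cat /= cats0.
have step m1 m : flatten [seq children u | u <- flatten [seq level i | i <- iota m1 m]] =
    flatten [seq level i | i <- iota m1.+1 m].
  by elim: m m1 => //= m IH m1; rewrite map_cat flatten_cat IH.
rewrite map_cat flatten_cat step -[flatten [seq _ | u <- level n]]/(level n.+1).
rewrite level_top cats0.
suff H m : flatten [seq level i | i <- iota 0 m] ++ level m =
  [::] :: flatten [seq level i | i <- iota 1 m] by exact: H.
rewrite -[RHS]/(flatten [seq level i | i <- iota 0 m.+1]) -addn1 iotaD add0n.
by rewrite map_cat flatten_cat /= cats0.
Qed.

(** Deleted words and proper suffixes are shorter than the word being scanned; this lemma places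
    them earlier in the queue, so that their table entries already exist. *)
Lemma index_shorter u v : is_word v -> size v < size u -> u \in words ->
  index v words < index u words.
Proof.
move=> wv lt_vu; rewrite mem_words => wu.
have le_u := size_word wu.
have -> : words = flatten [seq level m | m <- iota 0 (size u)] ++
                  flatten [seq level m | m <- iota (size u) (n.+1 - size u)].
  by rewrite -flatten_cat -map_cat -iotaD subnKC // leqW.
rewrite !index_cat ifT; last first.
  by apply/flatten_mapP; exists (size v); rewrite ?mem_iota // mem_level eqxx.
rewrite ifN; last by apply/negP => /words_before; rewrite add0n ltnn andbF.
apply: leq_trans (leq_addr _ _); rewrite index_mem.
by apply/flatten_mapP; exists (size v); rewrite ?mem_iota // mem_level eqxx.
Qed.

End Words.

(** * The recurrence counting hits *)

Section Recurrence.

(* rk i is the rank, among the positions of the i largest letters of the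
   pattern, of the position of the next letter; fb i forbids a gap after the i
   largest letters. *)
Variables (k : nat) (rk : nat -> nat) (fb : nat -> bool) (z : bool).

Definition extends (s : seq nat) (e : nat) : bool :=
  (size s < k) && (count (ltn^~ e) s == rk (size s)).

Definition matches (i : nat) (u : seq nat) : bool :=
  all (fun j => extends (take j u) (nth 0 u j)) (iota 0 i).

Definition mdepth (u : seq nat) : nat :=
  find (fun j => ~~ extends (take j u) (nth 0 u j)) (iota 0 (size u)).

(** [s] holds the entries chosen so far, [r] those still to be read; each entry is either chosen or
    skipped. For a word [u] with a matching prefix of length [i], P_i(u) is
    [count_hits (take i u) (drop i u)]. *)
Fixpoint count_hits (s r : seq nat) : nat :=
  if r is e :: r' then
    (if extends s e then count_hits (rcons s e) r' else 0) +
    (if fb (size s) then 0 else count_hits s r')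
  else (size s == k) && z.

Lemma count_hits_le s r : count_hits s r <= 2 ^ size r.
Proof.
elim: r s => [|e r IH] s /=; first by case: (_ && _).
rewrite expnS mul2n -addnn leq_add //; first by case: ifP.
by case: ifP.
Qed.

Lemma matchesS i u : matches i.+1 u = matches i u && extends (take i u) (nth 0 u i).
Proof. by rewrite /matches -addn1 iotaD all_cat /= andbT. Qed.

Lemma matches_mdepth i u : i <= size u -> matches i u = (i <= mdepth u).
Proof.
rewrite /matches /mdepth => le_i; apply/allP/idP => [H|le_d j].
  rewrite leqNgt; apply/negP => lt_d.
  have := nth_find 0 (a := fun j => ~~ extends (take j u) (nth 0 u j))
            (s := iota 0 (size u)).
  rewrite has_find size_iota => /(_ (leq_trans lt_d le_i)).
  rewrite nth_iota ?add0n; last exact: leq_trans lt_d le_i.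
  by rewrite H // mem_iota.
rewrite mem_iota /= add0n => lt_j.
have /(before_find 0) := leq_trans lt_j le_d.
by rewrite nth_iota ?add0n 1?(leq_trans lt_j) // => /negbFE.
Qed.

Lemma matches_take i u v : i <= size u -> i <= size v ->
  take i u = take i v -> matches i u = matches i v.
Proof.
move=> lu lv E; apply: eq_in_all => j; rewrite mem_iota /= add0n => lt_j.
rewrite -(nth_take 0 lt_j u) -(nth_take 0 lt_j v) E.
by rewrite -(take_takel u (ltnW lt_j)) -(take_takel v (ltnW lt_j)) E.
Qed.

Lemma mdepth_le u : mdepth u <= size u.
Proof. by rewrite -[leqRHS](size_iota 0) find_size. Qed.

Lemma matches_lt i u : i <= size u -> matches i u -> i <= k.
Proof. by case: i => // i lt_i; rewrite matchesS => /and3P[_ + _]; rewrite size_takel // ltnW. Qed.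

(** This is P_0(u) - P_i(u). If the prefix of length [i] matches, [count_hits_mono] shows that the
    subtraction is not truncated, and the difference counts the hits that omit one of the first [i]
    entries. *)
Definition skipped (u : seq nat) (i : nat) : nat :=
  count_hits [::] u - count_hits (take i u) (drop i u).

Definition delete (i : nat) (u : seq nat) : seq nat := take i u ++ drop i.+1 u.

Lemma count_hits_step i u : i < size u ->
  count_hits (take i u) (drop i u) =
  (if extends (take i u) (nth 0 u i)
   then count_hits (take i.+1 u) (drop i.+1 u) else 0) +
  (if fb i then 0 else count_hits (take i u) (drop i.+1 u)).
Proof.
by move=> lt_i; rewrite (drop_nth 0 lt_i) /= size_takel ?(ltnW lt_i) // -take_nth.
Qed.

Lemma count_hits_mono i u : i <= size u -> matches i u ->
  count_hits (take i u) (drop i u) <= count_hits [::] u.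
Proof.
elim: i => [|i IH] lt_i; first by rewrite take0 drop0.
rewrite matchesS => /andP[mi ext]; apply: leq_trans (IH (ltnW lt_i) mi).
by rewrite (count_hits_step lt_i) ext leq_addr.
Qed.

Lemma skipped0 u : skipped u 0 = 0.
Proof. by rewrite /skipped take0 drop0 subnn. Qed.

Lemma skippedS i u : i < size u -> matches i.+1 u ->
  skipped u i.+1 =
  skipped u i + (if fb i then 0 else count_hits (take i u) (drop i.+1 u)).
Proof.
move=> lt_i mi1; have := count_hits_mono lt_i mi1.
move: (mi1); rewrite matchesS => /andP[mi ext].
have := count_hits_mono (ltnW lt_i) mi.
rewrite /skipped (count_hits_step lt_i) ext; case: (fb i); lia.
Qed.

(** At the first mismatch the entry of index [i] cannot be chosen, so the summand for skipping it
    completes the count. *)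
Lemma skipped_stop i u : i < size u -> matches i u -> ~~ matches i.+1 u ->
  count_hits [::] u =
  skipped u i + (if fb i then 0 else count_hits (take i u) (drop i.+1 u)).
Proof.
move=> lt_i mi; have := count_hits_mono (ltnW lt_i) mi.
rewrite matchesS mi /= /skipped (count_hits_step lt_i) => + /negPf->; lia.
Qed.

Lemma skipped_end u : matches (size u) u ->
  count_hits [::] u = skipped u (size u) + ((size u == k) && z).
Proof.
move=> mu; have := count_hits_mono (leqnn _) mu.
rewrite /skipped take_size drop_size /=; lia.
Qed.

Lemma size_delete i u : i < size u -> size (delete i u) = (size u).-1.
Proof. by move=> lt_i; rewrite size_cat size_takel ?(ltnW lt_i) // size_drop; lia. Qed.

Lemma take_delete i u : i < size u -> take i (delete i u) = take i u.
Proof. by move=> lt_i; rewrite take_size_cat // size_takel // ltnW. Qed.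

Lemma drop_delete i u : i < size u -> drop i (delete i u) = drop i.+1 u.
Proof. by move=> lt_i; rewrite drop_size_cat // size_takel // ltnW. Qed.

Lemma matches_delete i u : i < size u -> matches i (delete i u) = matches i u.
Proof.
move=> lt_i; apply: matches_take; rewrite ?take_delete //; last exact: ltnW.
by rewrite size_delete //; case: (size u) lt_i.
Qed.

(** The deletion leaves the matching prefix of length [i] intact. The summand needed for [u] is
    therefore P_i of the shorter word, that is, its P_0 minus its stored difference. *)
Lemma count_hits_delete i u : i < size u -> matches i u ->
  count_hits [::] (delete i u) =
  skipped (delete i u) i + count_hits (take i u) (drop i.+1 u).
Proof.
move=> lt_i mi.
have := @count_hits_mono i (delete i u).
rewrite matches_delete // /skipped take_delete // drop_delete // size_delete //.
by move=> /(_ _ mi); case: (size u) lt_i => // m lt_i /(_ lt_i) => H; rewrite subnK.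
Qed.

(** * Exchanging matched entries, and the average length of a matching prefix *)

Definition swap (i : nat) (u : seq nat) : seq nat :=
  take i u ++ [:: nth 0 u i.+1, nth 0 u i & drop i.+2 u].

Lemma swap_split i u : i.+1 < size u ->
  u = take i u ++ [:: nth 0 u i, nth 0 u i.+1 & drop i.+2 u].
Proof.
by move=> lt_i; rewrite -{1}(cat_take_drop i u) (drop_nth 0 (ltnW lt_i)) (drop_nth 0 lt_i).
Qed.

Lemma swap_perm i u : i.+1 < size u -> perm_eq (swap i u) u.
Proof.
move=> lt_i; rewrite {2}(swap_split lt_i) perm_cat2l.
by rewrite -[[:: nth 0 u i.+1, _ & _]]/([:: _; _] ++ _) (perm_catCA [:: _] [:: _]).
Qed.

(* Two consecutive matched entries x, y have ranks that determine whether x < y,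
   so that exchanging them destroys the match. *)
Lemma swap_matches i u : uniq u -> i.+1 < size u ->
  matches i.+2 u -> matches i (swap i u) && ~~ matches i.+2 (swap i u).
Proof.
move=> uu lt_i; have szt : size (take i u) = i by rewrite size_takel //; lia.
have szs : size (swap i u) = size u by apply: perm_size; apply: swap_perm.
have tk : take i (swap i u) = take i u by rewrite /swap take_size_cat.
set x := nth 0 u i; set y := nth 0 u i.+1.
have nxy : x != y by rewrite nth_uniq //; lia.
have nx : nth 0 (swap i u) i = y by rewrite /swap nth_cat szt ltnn subnn.
have ny : nth 0 (swap i u) i.+1 = x by rewrite /swap nth_cat szt ltnNge leqnSn subSnn.
have tk1 : take i.+1 (swap i u) = rcons (take i u) y.
  by rewrite (take_nth 0) ?tk ?nx // szs ltnW.
have tku : take i.+1 u = rcons (take i u) x by rewrite (take_nth 0) // ltnW.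
have lei : i <= size u by rewrite ltnW // ltnW.
rewrite !matchesS (@matches_take i (swap i u) u) ?szs //.
move=> /andP[/andP[-> ex] ey] /=.
move: ex ey; rewrite tk nx ny tk1 tku /extends !size_rcons szt.
move=> /andP[-> /eqP rx] /andP[-> /eqP ry] /=.
rewrite -/x -/y in rx ry *; move: ry; rewrite -!cats1 !count_cat /= !addn0 => ry.
apply/negP => /andP[/eqP rx' /eqP ry'].
(* Both matches together give [rk i + (x < y) = rk i.+1 = rk i + (y < x)], impossible for distinct
   [x] and [y]. *)
move: nxy; rewrite neq_ltn; move: ry ry'; rewrite rx rx'.
case: ltngtP => //; lia.
Qed.

Lemma swapK i u : i.+1 < size u -> swap i (swap i u) = u.
Proof.
move=> lt_i; have szt : size (take i u) = i by rewrite size_takel //; lia.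
have E2 : i.+2 - i = 2 by rewrite -addn2 addKn.
have Ed : drop i.+2 (swap i u) = drop i.+2 u.
  by rewrite /swap drop_cat szt ltnNge ltnW //= E2 /= drop0.
rewrite [LHS]/swap Ed [in RHS](swap_split lt_i); congr (_ ++ _).
  by rewrite take_size_cat.
by rewrite /swap !nth_cat szt ltnn ltnNge leqnSn subSnn subnn.
Qed.

(** The terms of even index and those of odd index are each dominated by a geometric series of ratio
    one half with sum [2 * a 0]; hence the factor 4. The induction removes two terms at a time. *)
Lemma sum_halving (a : nat -> nat) M : (forall i, a i.+1 <= a i) ->
  (forall i, 2 * a i.+2 <= a i) -> \sum_(i < M) a i <= 4 * a 0.
Proof.
have [m] := ubnP M; elim: m M a => // m IH [|[|M]] a lt_M a1 a2.
- by rewrite big_ord0.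
- by rewrite big_ord1 /=; lia.
rewrite !big_ord_recl /= (eq_bigr (fun i : 'I_M => a i.+2)) //.
have := IH M (fun i => a i.+2) (ltnW lt_M) (fun i => a1 _) (fun i => a2 _).
have := a1 0; have := a2 0; move: (\sum_(_ < _) _) => S /=.
by rewrite /bump /= ?addn0; lia.
Qed.

(** The sum is rewritten by its tails: [a i] counts the words whose matching prefix has length at
    least [i], and these numbers satisfy the hypotheses of [sum_halving]. *)
Lemma sum_mdepth n m :
  \sum_(u <- level n m) (mdepth u).+1 <= 4 * size (level n m).
Proof.
pose a i := count (fun u => i <= mdepth u) (level n m).
have -> : size (level n m) = a 0 by rewrite /a -count_predT; apply: eq_count.
have lev u : u \in level n m -> size u = m /\ is_word n u.
  by rewrite mem_level => /andP[/eqP].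
have -> : \sum_(u <- level n m) (mdepth u).+1 = \sum_(i < m.+1) a i.
  under [RHS]eq_bigr => i _ do rewrite /a -sum1_count big_mkcond.
  rewrite exchange_big /= big_seq [RHS]big_seq; apply: eq_bigr => u /lev[su _].
  have le_m : mdepth u <= m by rewrite -su mdepth_le.
  rewrite -(big_mkord xpredT (fun i => if i <= mdepth u then 1 else 0)).
  rewrite (big_cat_nat (n := (mdepth u).+1)) //= -[LHS]addn0; congr (_ + _).
    rewrite (@eq_big_nat _ _ _ _ _ _ (fun=> 1)) ?sum_nat_const_nat ?subn0 ?muln1 //.
    by move=> i /andP[_ lt_i]; rewrite -ltnS lt_i.
  rewrite (@eq_big_nat _ _ _ _ _ _ (fun=> 0)) ?sum_nat_const_nat ?muln0 //.
  by move=> i /andP[lt_i _]; rewrite leqNgt lt_i.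
apply: sum_halving => i.
  by apply: sub_count => u; apply: leq_trans.
case: (ltnP m i.+2) => [lt_m|le_m].
  rewrite (_ : a i.+2 = 0) //; apply/eqP; rewrite -leqn0 leqNgt -has_count.
  apply/hasPn => u /lev[su _]; rewrite -ltnNge; apply: leq_trans lt_m.
  by rewrite ltnS -su mdepth_le.
(* [swap i] injects the words of depth at least [i.+2] into those of depth at least [i] but below
   [i.+2]. The domain and the image are thus disjoint subsets of the words counted by [a i]. *)
rewrite /a -!size_filter mul2n -addnn -{2}(size_map (swap i)) -size_cat.
apply: uniq_leq_size.
  rewrite cat_uniq filter_uniq ?level_uniq // map_inj_in_uniq ?filter_uniq ?level_uniq //.
    rewrite andbT; apply/hasPn => _ /mapP[u + ->].
    rewrite mem_filter => /andP[du /lev[su /andP[uu _]]].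
    have lt_i : i.+1 < size u by rewrite su.
    rewrite -matches_mdepth ?su // in du.
    have /andP[_] := swap_matches uu lt_i du.
    rewrite mem_filter matches_mdepth; first by move/negPf->.
    by rewrite (perm_size (swap_perm lt_i)) su.
  move=> u v; rewrite !mem_filter => /andP[_ /lev[su _]] /andP[_ /lev[sv _]] E.
  by rewrite -(@swapK i u) ?su // E swapK ?sv.
move=> u; rewrite mem_cat => /orP[|/mapP[v + ->]]; rewrite !mem_filter.
  by move=> /andP[le_u ->]; rewrite andbT; apply: leq_trans le_u; rewrite ltnW.
move=> /andP[dv lv]; have [sv wv] := lev v lv; have /andP[uv av] := wv.
have lt_i : i.+1 < size v by rewrite sv.
have pe := swap_perm lt_i.
rewrite -matches_mdepth ?sv // in dv; have /andP[ms _] := swap_matches uv lt_i dv.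
rewrite -matches_mdepth ?ms; last by rewrite (perm_size pe) sv; lia.
by rewrite mem_level (perm_size pe) sv eqxx /is_word (perm_uniq pe) uv (perm_all _ pe).
Qed.

End Recurrence.

(** * Encoding of words *)

Lemma digits_lt (d : nat -> nat) B q : (forall c, d c < B) ->
  \sum_(0 <= c < q) d c * B ^ c < B ^ q.
Proof.
move=> ltd; elim: q => [|q IH]; first by rewrite big_geq.
rewrite big_nat_recr //= expnS; have := ltd q; move: IH.
move: (\sum_(_ <= _ < _) _) (B ^ q) (d q) => s p x; nia.
Qed.

Lemma digits_inj (d d' : nat -> nat) B q :
  (forall c, d c < B) -> (forall c, d' c < B) ->
  \sum_(0 <= c < q) d c * B ^ c = \sum_(0 <= c < q) d' c * B ^ c ->
  forall c, c < q -> d c = d' c.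
Proof.
move=> ltd ltd'; elim: q => // q IH; rewrite !big_nat_recr //=.
have := digits_lt q ltd; have := digits_lt q ltd'.
set s := \sum_(_ <= _ < _) _; set s' := \sum_(_ <= _ < _) _ => lts' lts E.
have Eq : d q = d' q.
  have := congr1 (fun x => x %/ B ^ q) E; rewrite /= ![_ + _ * _]addnC.
  by rewrite !divnMDl ?divn_small ?addn0 // (leq_ltn_trans _ lts).
move=> c; rewrite ltnS leq_eqVlt => /orP[/eqP->//|]; apply: IH.
by move: E; rewrite Eq; lia.
Qed.

(** The head has the largest letter, the last entry the letter 1, and 0 marks an absent position.
    Letters are counted from the end, so prepending an entry changes no other letter. *)
Definition letter (u : seq nat) (a : nat) : nat :=
  if a \in u then size u - index a u else 0.

Section InverseWord.

Variable n : nat.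

(* A word lists positions, that of the largest letter first. *)
Definition inv_word (t : 'S_n) : seq nat :=
  rev [seq val ((t^-1)%g i) | i <- enum 'I_n].

Lemma inv_word_is_word t : is_word n (inv_word t).
Proof.
rewrite /is_word rev_uniq map_inj_uniq ?enum_uniq /=; last first.
  by move=> i j /val_inj /perm_inj.
by apply/allP => a; rewrite mem_rev => /mapP[i _ ->] /=.
Qed.

Lemma size_inv_word t : size (inv_word t) = n.
Proof. by rewrite size_rev size_map size_enum_ord. Qed.

Lemma letter_inv_word (t : 'S_n) (i : 'I_n) : letter (inv_word t) i = (t i).+1.
Proof.
have -> : val i = nth 0 (inv_word t) (n - (t i).+1).
  rewrite nth_rev size_map size_enum_ord; last by have := ltn_ord (t i); lia.
  have -> : n - (n - (t i).+1).+1 = t i by have := ltn_ord (t i); lia.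
  by rewrite (nth_map (t i)) ?size_enum_ord // nth_ord_enum permK.
have /andP[uu _] := inv_word_is_word t.
have lt_i : n - (t i).+1 < size (inv_word t).
  by rewrite size_inv_word; have := ltn_ord (t i); lia.
by rewrite /letter mem_nth // index_uniq // size_inv_word; have := ltn_ord (t i); lia.
Qed.

Lemma inv_word_inj : injective inv_word.
Proof.
move=> t t' E; apply/permP => i; apply: val_inj => /=.
by have := letter_inv_word t i; rewrite E letter_inv_word => -[].
Qed.

End InverseWord.

Section Encoding.

Variables D n b w : nat.

Let q := w %/ b.

(** What position [a] contributes to machine word [j] per unit of its letter. These values are
    tabulated once, so that encodings are updated by multiplications and additions only. *)
Definition block (j a : nat) : nat := (a %/ q == j) * 2 ^ (b * (a %% q)).

Fixpoint enc (j : nat) (u : seq nat) : nat :=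
  if u is a :: u' then (size u) * block j a + enc j u' else 0.

Definition key (u : seq nat) : seq nat := mkseq (enc^~ u) D.

Lemma letter_cons a u a' :
  letter (a :: u) a' = if a' == a then (size u).+1 else letter u a'.
Proof.
rewrite /letter inE /= eq_sym; case: eqP => [//|_] /=; by rewrite subSS.
Qed.

Lemma enc_letter j u : is_word n u ->
  enc j u = \sum_(0 <= a < n) letter u a * block j a.
Proof.
elim: u => [|a u IH] wu.
  by rewrite /= big1 // => i _; rewrite /letter mul0n.
have {wu} [na wu lt_a] : [/\ a \notin u, is_word n u & a < n].
  by move: wu => /andP[/= /andP[-> uu] /andP[-> au]]; rewrite /is_word uu.
rewrite /= IH //.
rewrite (bigD1_seq a) ?iota_uniq ?mem_index_iota //=.
rewrite [RHS](bigD1_seq a) ?iota_uniq ?mem_index_iota //=.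
rewrite letter_cons eqxx {1}/letter (negPf na) mul0n add0n; congr (_ + _).
by apply: eq_bigr => i /negPf ne; rewrite letter_cons ne.
Qed.

Lemma letter_le u a : letter u a <= size u.
Proof. by rewrite /letter; case: ifP => // _; rewrite leq_subr. Qed.

Lemma letter_out u a : is_word n u -> n <= a -> letter u a = 0.
Proof.
move=> /andP[_ /allP lt_u] le_a; rewrite /letter ifN //.
by apply/negP => /lt_u /=; rewrite ltnNge le_a.
Qed.

Lemma letter_inj u v : is_word n u -> is_word n v ->
  (forall a, a < n -> letter u a = letter v a) -> u = v.
Proof.
move=> wu wv E.
have {}E a : letter u a = letter v a.
  by case: (ltnP a n) => [|le]; [apply: E | rewrite !letter_out].
have pos x a : (0 < letter x a) = (a \in x).
  by rewrite /letter; case: ifP => // ax; rewrite subn_gt0 index_mem.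
have mem : u =i v by move=> a; rewrite -!pos E.
have /andP[uu _] := wu; have /andP[uv _] := wv.
have sz : size u = size v by apply: perm_size; apply: uniq_perm.
apply: (eq_from_nth (x0 := 0) sz) => i lt_i.
have au : nth 0 u i \in u by rewrite mem_nth.
have := E (nth 0 u i); rewrite /letter au -mem au index_uniq // sz => Ei.
have lt_v : index (nth 0 u i) v < size v by rewrite index_mem -mem.
have -> : i = index (nth 0 u i) v by rewrite sz in lt_i; lia.
by rewrite nth_index // -?mem // {1}(_ : index _ _ = i) //; rewrite sz in lt_i; lia.
Qed.

Lemma key_inv_word (t : 'S_n) : key (inv_word t) = encode_perm D b w t.
Proof.
apply: eq_map => j; rewrite enc_letter ?inv_word_is_word // big_mkord.
rewrite [RHS]big_mkcond; apply: eq_bigr => i _.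
by rewrite letter_inv_word /block -/q; case: eqP => _; rewrite ?mul1n ?mul0n ?muln0.
Qed.

Lemma enc_drop j u i : i < size u ->
  enc j (drop i u) = (size u - i) * block j (nth 0 u i) + enc j (drop i.+1 u).
Proof. by move=> lt_i; rewrite (drop_nth 0 lt_i) /= size_drop -(subnSK lt_i). Qed.

(* The prefix of length i of u, its letters decreased by one. *)
Definition enc_prefix (j : nat) (u : seq nat) (i : nat) : nat :=
  \sum_(0 <= i' < i) (size u - i'.+1) * block j (nth 0 u i').

(** Entries behind the deleted one keep their letters and those in front lose one unit. The key of
    the deleted word is thus the sum of two vectors that the scan maintains anyway. *)
Lemma enc_delete j u i : i < size u ->
  enc j (delete i u) = enc j (drop i.+1 u) + enc_prefix j u i.
Proof.
move=> lt_i.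
have cat s r : enc j (s ++ r) =
    enc j r + \sum_(0 <= i' < size s) (size s + size r - i') * block j (nth 0 s i').
  elim: s => [|a s IH] /=; first by rewrite big_geq // addn0.
  rewrite IH big_nat_recl //= size_cat subn0.
  under [in RHS]eq_bigr do rewrite addSn subSS; lia.
rewrite /delete cat size_takel ?(ltnW lt_i) // size_drop /enc_prefix; congr (_ + _).
rewrite big_nat [RHS]big_nat; apply: eq_bigr => i' /andP[_ lt_i'].
by rewrite nth_take //; congr (_ * _); lia.
Qed.

Hypothesis fits : perm_fits D n b w.

Lemma enc_digits j u : j < D -> is_word n u ->
  enc j u = \sum_(0 <= c < q) letter u (c + j * q) * (2 ^ b) ^ c.
Proof.
move=> lt_j wu; have /and4P[_ _ leD _] := fits.
rewrite enc_letter //.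
have -> : \sum_(0 <= a < n) letter u a * block j a =
          \sum_(0 <= a < D * q) letter u a * block j a.
  rewrite (big_cat_nat (n := n) (p := D * q)) //= [X in _ = _ + X]big_nat.
  by rewrite [X in _ = _ + X]big1 ?addn0 // => a /andP[le_a _]; rewrite letter_out.
have le_jq : j * q <= j.+1 * q by rewrite leq_mul2r leqnSn orbT.
have le_jD : j.+1 * q <= D * q by rewrite leq_mul2r lt_j orbT.
rewrite (big_cat_nat (n := j * q)) //=; last exact: leq_trans le_jD.
rewrite [X in X + _]big_nat [X in X + _]big1 ?add0n; last first.
  move=> a /andP[_ lt_a]; rewrite /block ltn_eqF ?mul0n ?muln0 //.
  by rewrite ltn_divLR //; case: (q) lt_a => //; rewrite muln0.
rewrite (big_cat_nat (n := j.+1 * q)) //= [X in _ + X]big_nat [X in _ + X]big1 ?addn0.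
  rewrite -{1}[j * q]add0n big_addn mulSn addnK big_nat [RHS]big_nat.
  apply: eq_bigr => c /andP[_ lt_c]; rewrite /block.
  have q_gt0 : 0 < q by apply: leq_ltn_trans lt_c.
  rewrite divnDMl // divn_small // add0n eqxx mul1n addnC modnMDl modn_small //.
  by rewrite expnM addnC.
move=> a /andP[le_a lt_a]; rewrite /block gtn_eqF ?mul0n ?muln0 //.
by rewrite leq_divRL //; case: (q) lt_a => //; rewrite muln0.
Qed.

Lemma letter_lt u a : is_word n u -> letter u a < 2 ^ b.
Proof.
move=> wu; have /and4P[lt_n _ _ _] := fits; apply: leq_ltn_trans lt_n.
exact: leq_trans (letter_le _ _) (size_word wu).
Qed.

Lemma enc_lt j u : j < D -> is_word n u -> enc j u < 2 ^ w.
Proof.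
move=> lt_j wu; rewrite enc_digits //.
apply: leq_trans (digits_lt (d := fun c => letter u (c + j * q)) q _) _.
  by move=> c; apply: letter_lt.
by rewrite -expnM leq_exp2l // mulnC leq_trunc_div.
Qed.

(** Each coordinate is an expansion in base [2 ^ b] whose digits are the letters of its [q]
    positions, so the key determines every letter and the letters determine the word. *)
Lemma key_inj u v : is_word n u -> is_word n v -> key u = key v -> u = v.
Proof.
move=> wu wv E; apply: letter_inj => // a lt_a.
have /and4P[_ _ leD _] := fits.
have q_gt0 : 0 < q by move: leD; rewrite -/q; case: (q) => //; rewrite muln0; lia.
have lt_j : a %/ q < D by rewrite ltn_divLR //; apply: leq_trans leD.
have := congr1 (fun s => nth 0 s (a %/ q)) E; rewrite /= !nth_mkseq //.
rewrite !enc_digits // => /digits_inj H.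
have := H (fun c => letter_lt _ wu) (fun c => letter_lt _ wv) (a %% q).
by rewrite /= addnC -divn_eq; apply; rewrite ltn_mod.
Qed.

Lemma encode_perm_inj : injective (@encode_perm D n b w).
Proof.
move=> t t'; rewrite -!key_inv_word => /key_inj E; apply: inv_word_inj.
by apply: E; apply: inv_word_is_word.
Qed.

End Encoding.

(** * The recurrence computes the number of hits *)

Fixpoint masks (l : nat) : seq (seq bool) :=
  if l is l'.+1 then
    [seq true :: m | m <- masks l'] ++ [seq false :: m | m <- masks l']
  else [:: [::]].

Lemma mem_masks l m : (m \in masks l) = (size m == l).
Proof.
elim: l m => [|l IH] [|c m] //=; rewrite mem_cat.
  by apply/negP => /orP[] /mapP[].
rewrite eqSS -IH; apply/orP/idP => [[] /mapP[m' mm' [_ ->]] //|mm].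
by case: c; [left | right]; apply/mapP; exists m.
Qed.

Lemma masks_uniq l : uniq (masks l).
Proof.
elim: l => //= l IH; rewrite cat_uniq !map_inj_uniq ?IH ?andbT //= => [|m m' []//|m m' []//].
by apply/hasPn => _ /mapP[m _ ->]; apply/mapP => -[].
Qed.

Section CountMasks.

Variables (k : nat) (rk : nat -> nat) (fb : nat -> bool) (z : bool).

Fixpoint ranked (s v : seq nat) : bool :=
  if v is e :: v' then extends k rk s e && ranked (rcons s e) v' else true.

Fixpoint gaps (i : nat) (m : seq bool) : bool :=
  if m is c :: m' then (if c then gaps i.+1 m' else ~~ fb i && gaps i m')
  else true.

(** One bit of a mask records one decision of the recurrence, [true] for choosing the entry. This
    turns the recursion into the cardinality of a set of masks, to be compared with the set of
    hits. *)
Lemma count_hits_masks s r :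
  count_hits k rk fb z s r =
  count (fun m => [&& ranked s (mask m r), gaps (size s) m,
                      size s + size (mask m r) == k & z]) (masks (size r)).
Proof.
elim: r s => [|e r IH] s /=; first by rewrite !addn0.
rewrite count_cat !count_map; congr (_ + _).
  case: ifP => ext; last by rewrite (@eq_count _ _ pred0) ?count_pred0 // => m /=; rewrite ext.
  rewrite IH; apply: eq_count => m /=.
  by rewrite ext size_rcons addSnnS.
case: ifP => fbs; first by rewrite (@eq_count _ _ pred0) ?count_pred0 // => m /=; rewrite fbs andbF.
by rewrite IH; apply: eq_count => m /=; rewrite fbs.
Qed.

Lemma rankedP s v : ranked s v =
  all (fun i => extends k rk (s ++ take i v) (nth 0 v i)) (iota 0 (size v)).
Proof.
elim: v s => //= e v IH s; rewrite cats0 IH -(addn0 1) iotaDl all_map; congr (_ && _).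
by apply: eq_all => i /=; rewrite cat_rcons.
Qed.

(** Values are read in decreasing order, so when [v] is reached the number of chosen entries is the
    number of members of [Bs] above [v]. *)
Lemma gaps_values (Bs : seq nat) n : uniq Bs ->
  gaps (count (leq n) Bs) [seq v \in Bs | v <- rev (iota 0 n)] =
  all (fun v => (v \in Bs) || ~~ fb (count (ltn v) Bs)) (iota 0 n).
Proof.
move=> uB; elim: n => // n IH.
rewrite -addn1 iotaD add0n rev_cat all_cat /= andbT -IH addn1.
have E : count (leq n) Bs = count (ltn n) Bs + (n \in Bs).
  rewrite -count_uniq_mem //; elim: (Bs) => //= x s ->.
  by case: (ltngtP n x) => /=; lia.
rewrite E; case: (boolP (n \in Bs)) => nB /=; first by rewrite addn1 andbT.
by rewrite addn0 andbC.
Qed.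

End CountMasks.

(** An arrangement of a given set is determined by the ranks of its entries among their
    predecessors, as for Lehmer codes. The last rank is a rank in the whole set and thus identifies
    the last entry, which is then removed. *)
Lemma rank_code_inj (U V : seq nat) : uniq U -> perm_eq U V ->
  (forall i, i < size U ->
     count (ltn^~ (nth 0 U i)) (take i U) = count (ltn^~ (nth 0 V i)) (take i V)) ->
  U = V.
Proof.
elim/last_ind: U V => [|U a IH] V uU pUV code.
  by have := perm_size pUV => /esym/size0nil ->.
case/lastP: V pUV code => [/perm_size|V b pUV code]; first by rewrite size_rcons.
have sz : size U = size V by have := perm_size pUV; rewrite !size_rcons => -[].
have cE c : count (ltn^~ c) (rcons U a) = count (ltn^~ c) (rcons V b).
  by move/seq.permP: pUV; apply.
have Ec : count (ltn^~ a) U = count (ltn^~ b) V.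
  have := code (size U); rewrite size_rcons ltnSn => /(_ isT).
  by rewrite !nth_rcons sz !ltnn !eqxx -!cats1 !take_size_cat.
(* [a] and [b] have the same rank in one common set containing both, and rank is strictly increasing
   on the members of a set. *)
have Eab : a = b.
  have ab : count (ltn^~ a) (rcons U a) = count (ltn^~ b) (rcons U a).
    by rewrite (cE b) -!cats1 !count_cat /= !ltnn Ec.
  have strict x y s : x \in s -> x < y -> count (ltn^~ x) s < count (ltn^~ y) s.
    move=> xs lt_xy; rewrite -!size_filter.
    have -> : [seq c <- s | c < x] = [seq c <- [seq c <- s | c < y] | c < x].
      rewrite -filter_predI; apply: eq_filter => c /=.
      by case: ltnP => //= lt; rewrite (ltn_trans lt).
    rewrite size_filter -[ltnRHS](count_predC (ltn^~ x)) -[ltnLHS]addn0 ltn_add2l.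
    by rewrite -has_count; apply/hasP; exists x; [rewrite mem_filter xs andbT | rewrite /= -leqNgt].
  have aU : a \in rcons U a by rewrite mem_rcons mem_head.
  have bU : b \in rcons U a by rewrite (perm_mem pUV) mem_rcons mem_head.
  case: (ltngtP a b) => // lt.
    by have := strict _ _ _ aU lt; rewrite ab ltnn.
  by have := strict _ _ _ bU lt; rewrite ab ltnn.
rewrite -Eab in pUV code *; congr rcons; apply: IH.
- by move: uU; rewrite rcons_uniq => /andP[].
- by move: pUV; rewrite -!cats1 perm_cat2r.
move=> i lt_i; have := code i; rewrite size_rcons ltnS ltnW // => /(_ isT).
by rewrite -!cats1 !nth_cat -sz lt_i !takel_cat // -?sz; apply: ltnW.
Qed.

(* The x-th condition of an increasing sequence B says that no value is skipped
   between its first x terms and the others. *)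
Lemma adjacent_no_skip (B : nat -> nat) k n (Xp : nat -> bool) : 0 < k ->
  (forall x y, x < y < k -> B x < B y) -> (forall x, x < k -> B x < n) ->
  (forall x, x <= k -> Xp x ->
     [&& (0 < x < k) ==> (B x == (B x.-1).+1), (x == 0) ==> (B 0 == 0)
       & (x == k) ==> (B k.-1 == n.-1)]) <->
  (forall v, v < n -> v \notin mkseq B k -> ~~ Xp (count (ltn^~ v) (mkseq B k))).
Proof.
move=> k_gt0 incr ltB.
have cnt v c : c <= k -> (forall x, x < c -> B x < v) ->
    (forall x, c <= x < k -> v < B x) -> count (ltn^~ v) (mkseq B k) = c.
  move=> le_c lo hi; rewrite count_map -(subnKC le_c) iotaD count_cat add0n.
  rewrite (@eq_in_count _ _ xpredT) ?count_predT ?size_iota => [|x]; last first.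
    by rewrite mem_iota /= add0n => /lo ->.
  rewrite (@eq_in_count _ _ pred0) ?count_pred0 ?addn0 // => x.
  rewrite mem_iota subnKC // => /hi lt /=; lia.
have incr' x y : x <= y < k -> B x <= B y.
  by rewrite leq_eqVlt => /andP[/orP[/eqP->//|lt_xy] lt_y]; rewrite ltnW // incr // lt_xy.
have notin v c : c <= k -> (forall x, x < c -> B x < v) ->
    (forall x, c <= x < k -> v < B x) -> v \notin mkseq B k.
  move=> le_c lo hi; apply/negP => /mapP[x]; rewrite mem_iota /= add0n => lt_x Ev.
  by case: (ltnP x c) => [/lo|le]; [|have := hi x; rewrite le lt_x => /(_ isT)]; rewrite Ev ltnn.
split=> [adj v lt_v nv|noskip c le_c Xc].
  set c := count _ _.
  have [le_c lo hi] : [/\ c <= k, forall x, x < c -> B x < v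
                        & forall x, c <= x < k -> v < B x].
    pose c' := find (fun x => v < B x) (iota 0 k).
    have le_c' : c' <= k by rewrite -[leqRHS](size_iota 0) find_size.
    have lo x : x < c' -> B x < v.
      move=> lt_x; have lt_k : x < k by apply: leq_trans le_c'.
      have /= := before_find 0 lt_x; rewrite nth_iota // add0n => /negbT; rewrite -leqNgt.
      rewrite leq_eqVlt => /orP[/eqP E|//]; case/negP: nv; apply/mapP.
      by exists x; rewrite ?mem_iota.
    have hi x : c' <= x < k -> v < B x.
      move=> /andP[le_x lt_x].
      have := nth_find 0 (a := fun x => v < B x) (s := iota 0 k).
      rewrite has_find size_iota -/c' => /(_ (leq_ltn_trans le_x lt_x)).
      rewrite nth_iota ?add0n; last exact: leq_ltn_trans le_x lt_x.
      by move=> /leq_trans; apply; rewrite incr' // le_x.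
    by rewrite /c (cnt v c').
  apply/negP => Xc; have /and3P[H1 H2 H3] := adj c le_c Xc.
  have [c0|c_gt0] := posnP c.
    move: H2; rewrite c0 eqxx /= => /eqP E; have := hi 0; rewrite c0 k_gt0 E => /(_ isT).
    by [].
  have [lt_ck|gt_ck|ck] := ltngtP c k.
  - move: H1; rewrite c_gt0 lt_ck /= => /eqP E.
    have := hi c; rewrite leqnn lt_ck E => /(_ isT).
    by have := lo c.-1; rewrite prednK // leqnn => /(_ isT); lia.
  - by rewrite ltnNge le_c in gt_ck.
  move: H3; rewrite ck eqxx /= => /eqP E; have := lo k.-1.
  by rewrite ck E prednK // leqnn => /(_ isT); lia.
(* If a condition fails, some skipped value has exactly [c] terms below it: the successor of the
   term of index [c.-1] in the middle case, 0 for [c = 0], and [n.-1] for [c = k]. *)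
apply/and3P; split; apply/implyP.
- move=> /andP[c_gt0 lt_c]; apply/negPn/negP => ne.
  have lt1 : B c.-1 < B c by rewrite incr // lt_c prednK // leqnn.
  have lo x : x < c -> B x < (B c.-1).+1.
    by move=> lt_x; rewrite ltnS; apply: incr'; lia.
  have hi x : c <= x < k -> (B c.-1).+1 < B x.
    by move=> /andP[le_x lt_x]; have := incr' c x; rewrite le_x lt_x => /(_ isT); move/eqP: ne; lia.
  have := noskip (B c.-1).+1; rewrite (cnt _ c) // (notin _ c) // Xc => H.
  by have := ltB c lt_c; move/eqP: ne => ne; have := H; case: ltnP => [_ /(_ isT isT)//|]; lia.
- move=> /eqP c0; apply/negPn/negP => ne.
  have hi x : 0 <= x < k -> 0 < B x.
    by move=> /andP[le_x lt_x]; have := incr' 0 x; rewrite lt_x => /(_ isT); rewrite -lt0n in ne; lia.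
  rewrite c0 in Xc; have := noskip 0; rewrite (cnt _ 0) // (notin _ 0) // Xc => H.
  by have := H (leq_ltn_trans (leq0n _) (ltB 0 k_gt0)) isT.
move=> /eqP ck; apply/negPn/negP => ne.
have lt1 : B k.-1 < n by rewrite ltB // prednK.
have lo x : x < k -> B x < n.-1.
  move=> lt_x; have := incr' x k.-1; rewrite -ltnS prednK // lt_x leqnn => /(_ isT).
  by move/eqP: ne; lia.
have hi x : k <= x < k -> n.-1 < B x by lia.
have lt_n : n.-1 < n by lia.
by rewrite ck in Xc; have := noskip n.-1 lt_n; rewrite (cnt _ k) // (notin _ k) // Xc => /(_ isT).
Qed.

Lemma sorted_enum_ord m : sorted (fun i j : 'I_m => i < j) (enum 'I_m).
Proof.
by have := iota_ltn_sorted 0 m; rewrite -val_enum_ord sorted_map.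
Qed.

Section HitsCount.

Variables (k n : nat) (p : 'S_k) (X : {set 'I_k.+1}) (t : 'S_n).

Definition pattern_rank (i : nat) : nat :=
  count (ltn^~ (nth 0 (inv_word p) i)) (take i (inv_word p)).

Definition constrained (x : nat) : bool :=
  nth false [seq x \in X | x <- enum 'I_k.+1] x.

(* For k = 0 the conditions 0 \in X and k \in X speak of a letter that does not
   exist and fail. *)
Definition satisfiable : bool := ~~ ((k == 0) && constrained 0).

Lemma constrained_ord (x : 'I_k.+1) : constrained x = (x \in X).
Proof. by rewrite /constrained (nth_map ord0) ?size_enum_ord // nth_ord_enum. Qed.

(** [W] and [Q] list the positions of the text and of the pattern by decreasing letter. The
    positions chosen by [f] are listed in the order of the text by [V f] and in the order demanded
    by the pattern by [U f]. [Phi f] is the mask selecting them in [W], and [Bs f] lists their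
    letters, minus one, from the smallest pattern letter upwards. *)
Let W := rev [seq (t^-1)%g i | i <- enum 'I_n].
Let Q := rev [seq (p^-1)%g i | i <- enum 'I_k].
Let R (a b : 'I_n) := t b < t a.
Let V (f : {ffun 'I_k -> 'I_n}) := [seq a <- W | a \in codom f].
Let U (f : {ffun 'I_k -> 'I_n}) := [seq f i | i <- Q].
Let Phi (f : {ffun 'I_k -> 'I_n}) := [seq a \in codom f | a <- W].
Let Bs (f : {ffun 'I_k -> 'I_n}) := [seq val (t (f ((p^-1)%g i))) | i <- enum 'I_k].

Let inv_wordW : inv_word t = map val W.
Proof. by rewrite /inv_word /W map_rev -[in RHS]map_comp. Qed.

Let inv_wordQ : inv_word p = map val Q.
Proof. by rewrite /inv_word /Q map_rev -[in RHS]map_comp. Qed.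

Let mem_W a : a \in W.
Proof. by rewrite mem_rev; apply/mapP; exists (t a); rewrite ?mem_enum ?permK. Qed.

Let mem_Q a : a \in Q.
Proof. by rewrite mem_rev; apply/mapP; exists (p a); rewrite ?mem_enum ?permK. Qed.

Let uniq_W : uniq W.
Proof. by rewrite rev_uniq map_inj_uniq ?enum_uniq //; apply: perm_inj. Qed.

Let uniq_Q : uniq Q.
Proof. by rewrite rev_uniq map_inj_uniq ?enum_uniq //; apply: perm_inj. Qed.

Let size_Q : size Q = k.
Proof. by rewrite size_rev size_map size_enum_ord. Qed.

Let R_trans : transitive R.
Proof. by move=> b a c ab bc; apply: ltn_trans bc ab. Qed.

Let R_irr : irreflexive R.
Proof. by move=> a; rewrite /R ltnn. Qed.

Let sorted_W : sorted R W.
Proof.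
rewrite rev_sorted sorted_map; apply: sub_sorted (sorted_enum_ord n) => i j.
by rewrite /relpre /R /= !permKV.
Qed.

Let mem_VU f : V f =i U f.
Proof.
move=> a; rewrite mem_filter mem_W andbT; apply/codomP/mapP => -[i]; last by exists i.
by exists i.
Qed.

Lemma incr_inj (f : {ffun 'I_k -> 'I_n}) : increasing_positions f -> injective f.
Proof.
move=> incr i j E; apply: val_inj => /=; case: (ltngtP i j) => // lt.
  by have /forallP/(_ i)/forallP/(_ j) := incr; rewrite lt E ltnn.
by have /forallP/(_ j)/forallP/(_ i) := incr; rewrite lt E ltnn.
Qed.

Lemma incr_lt (f : {ffun 'I_k -> 'I_n}) i j : increasing_positions f -> (f i < f j) = (i < j).
Proof.
move=> incr; case: (ltngtP i j) => [lt|lt|/val_inj->]; last by rewrite ltnn.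
  by have /forallP/(_ i)/forallP/(_ j) := incr; rewrite lt.
by have /forallP/(_ j)/forallP/(_ i) := incr; rewrite lt => /= /ltnW; case: ltnP => // ; lia.
Qed.

(** Both lists have the same members, and [V f] is sorted by decreasing letter of the text. They
    agree exactly if [U f] is sorted in this way too, which is order isomorphism. *)
Let iso_VU f : order_isomorphic p t f = (V f == U f).
Proof.
have sV : sorted R (V f) by apply: sorted_filter R_trans _ _ sorted_W.
apply/idP/eqP => [/forallP iso|E].
  apply: (irr_sorted_eq R_trans R_irr sV _ (@mem_VU f)).
  rewrite /U sorted_map rev_sorted sorted_map.
  apply: sub_sorted (sorted_enum_ord k) => i j lt_ij.
  have /forallP/(_ ((p^-1)%g j)) := iso ((p^-1)%g i).
  by rewrite /subseq_letter ltnS !permKV lt_ij /relpre /R /= => /eqP ->.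
have lt_t (i j : 'I_k) : i < j -> t (f ((p^-1)%g i)) < t (f ((p^-1)%g j)).
  move: sV; rewrite E /U sorted_map rev_sorted sorted_map => sU lt_ij.
  have tr : transitive (relpre (fun x => (p^-1)%g x) (fun y x : 'I_k => relpre f R x y)).
    by move=> b a c /= ab bc; apply: R_trans bc ab.
  have := sorted_ltn_nth tr i sU; move=> /(_ i j); rewrite !inE size_enum_ord !ltn_ord.
  by move=> /(_ isT isT lt_ij); rewrite !nth_ord_enum.
apply/forallP => a; apply/forallP => b; rewrite /subseq_letter ltnS.
case: (ltngtP (p a) (p b)) => [/lt_t|/lt_t|/val_inj /perm_inj ->]; rewrite ?permK ?ltnn //.
  by move=> ->.
by move=> lt; rewrite ltnNge ltnW.
Qed.

Let mask_Phi f : mask (Phi f) (inv_word t) = map val (V f).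
Proof. by rewrite inv_wordW -map_mask -filter_mask. Qed.

(** An increasing [f] preserves ranks, so [U f] has the rank code of the pattern. If [V f] has this
    code as well, [rank_code_inj] identifies the two lists. *)
Let ranked_VU f rk : (forall i, i < k -> rk i = pattern_rank i) ->
  increasing_positions f ->
  ranked k rk [::] (map val (V f)) && (size (V f) == k) = (V f == U f).
Proof.
move=> rkE incr.
have szU : size (U f) = k by rewrite size_map.
have uU : uniq (U f) by rewrite map_inj_uniq //; apply: incr_inj.
have uV : uniq (V f) by rewrite filter_uniq.
have codeU i : i < k ->
    count (ltn^~ (nth 0 (map val (U f)) i)) (take i (map val (U f))) = rk i.
  move=> lt_i; rewrite rkE // /pattern_rank inv_wordQ.
  have i0 : 'I_k by case: (k) lt_i => // m _; exact: ord0.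
  rewrite (nth_map (f i0)) ?szU // /U !(nth_map i0) ?size_Q //.
  rewrite -!map_take !count_map; apply: eq_count => a /=; exact: incr_lt.
apply/andP/eqP => [[]|E].
  rewrite rankedP size_map => /allP rV /eqP szV.
  have E : map val (V f) = map val (U f).
    apply: rank_code_inj.
    - by rewrite map_inj_uniq //; apply: val_inj.
    - by apply: perm_map; apply: uniq_perm => //; apply: mem_VU.
    rewrite size_map szV => i lt_i; rewrite codeU //.
    have := rV i; rewrite mem_iota szV => /(_ lt_i) /andP[_ /eqP].
    by rewrite cat0s => ->; rewrite size_takel // size_map szV ltnW.
  exact: inj_map val_inj _ _ E.
rewrite E szU eqxx; split=> //; rewrite rankedP size_map szU; apply/allP => i.
rewrite mem_iota add0n cat0s => /= lt_i; rewrite /extends codeU //.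
by rewrite size_takel ?lt_i ?eqxx // size_map szU ltnW.
Qed.

Let sorted_letterE f x : order_isomorphic p t f -> 0 < x <= k ->
  sorted_letter t f x = (nth 0 (Bs f) x.-1).+1.
Proof.
move=> /forallP iso /andP[x_gt0 le_x]; rewrite /sorted_letter.
have -> : sort leq [seq subseq_letter t f i | i <- enum 'I_k] = map succn (Bs f).
  apply: (sorted_eq leq_trans anti_leq (sort_sorted leq_total _)).
    rewrite /Bs -(map_comp succn) sorted_map; apply: sub_sorted (sorted_enum_ord k) => i j lt_ij.
    have /forallP/(_ ((p^-1)%g j)) := iso ((p^-1)%g i).
    by rewrite /subseq_letter ltnS !permKV lt_ij /= => /eqP /ltnW.
  rewrite perm_sort /Bs -(map_comp succn).
  have /perm_map pe : perm_eq (enum 'I_k) [seq (p^-1)%g i | i <- enum 'I_k].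
    apply: uniq_perm; first exact: enum_uniq.
      by rewrite map_inj_uniq ?enum_uniq //; apply: perm_inj.
    by move=> i; rewrite mem_enum; apply/esym/mapP; exists (p i); rewrite ?mem_enum ?permK.
  by apply: perm_trans (pe _ _) _; rewrite -(map_comp (subseq_letter t f)); apply: perm_refl.
by rewrite (nth_map 0) // size_map size_enum_ord; lia.
Qed.

(** After the [i] largest letters have been chosen, a skipped value lies below them and above the
    remaining [k - i]. It therefore violates the condition at [x = k - i]; hence the reversed
    index. *)
Let adjacency_gaps f : increasing_positions f -> order_isomorphic p t f ->
  adjacency_conditions X t f =
  gaps (fun i => constrained (k - i)) 0 (Phi f) && satisfiable.
Proof.
move=> incr iso; have sL := sorted_letterE iso; move/forallP: iso => iso.
have szB : size (Bs f) = k by rewrite size_map size_enum_ord.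
have uB : uniq (Bs f).
  rewrite map_inj_uniq ?enum_uniq // => i j /val_inj /perm_inj /(incr_inj incr).
  exact: perm_inj.
have ltB v : v \in Bs f -> v < n by case/mapP => i _ ->; apply: ltn_ord.
have PhiE : Phi f = [seq v \in Bs f | v <- rev (iota 0 n)].
  rewrite /Phi /W -val_enum_ord -!map_rev -[LHS]map_comp -[RHS]map_comp; apply: eq_map => i /=.
  apply/codomP/mapP => [[j E]|[j _ E]].
    by exists (p j); rewrite ?mem_enum // permK -E permKV.
  by exists ((p^-1)%g j); rewrite -[i]/(i) (val_inj E) permK.
have c0 : count (leq n) (Bs f) = 0.
  by apply/eqP; rewrite -leqn0 leqNgt -has_count; apply/hasPn => v /ltB; rewrite ltnNge.
rewrite PhiE -{1}c0 gaps_values //.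
case: (posnP k) => [k0|k_gt0].
  have -> : satisfiable = (ord0 \notin X).
    by rewrite /satisfiable (introT eqP k0) /= -(constrained_ord ord0).
  have cnt v : count (ltn v) (Bs f) = 0.
    by apply/eqP; rewrite -leqn0 (leq_trans (count_size _ _)) // szB k0.
  apply/idP/andP => [adj|[_ nX]].
    (* The list of letters is empty, so [sorted_letter] returns its default 0 instead of the
       required 1. *)
    have nX : ord0 \notin X.
      apply/negP => X0; have /forallP/(_ ord0) := adj; rewrite X0 /=.
      by rewrite /sorted_letter nth_default ?andbF // size_sort size_map size_enum_ord k0.
    split=> //; apply/allP => v _; rewrite cnt subn0 k0.
    by rewrite (constrained_ord ord0) nX orbT.
  apply/forallP => x; have -> : x = ord0 by apply: val_inj => /=; have := ltn_ord x; lia.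
  by rewrite (negPf nX).
rewrite /satisfiable gtn_eqF // andbT.
have := @adjacent_no_skip (nth 0 (Bs f)) k n constrained k_gt0.
have mB : mkseq (nth 0 (Bs f)) k = Bs f by rewrite -[RHS](mkseq_nth 0) szB.
rewrite mB => H.
have lt_t (i j : 'I_k) : i < j -> t (f ((p^-1)%g i)) < t (f ((p^-1)%g j)).
  move=> lt_ij; have /forallP/(_ ((p^-1)%g j)) := iso ((p^-1)%g i).
  by rewrite /subseq_letter ltnS !permKV lt_ij => /eqP.
have nthB (i : 'I_k) : nth 0 (Bs f) i = t (f ((p^-1)%g i)).
  by rewrite (nth_map i) ?size_enum_ord // nth_ord_enum.
have {H} [||H1 H2] := H.
- move=> x y /andP[lt_xy lt_y]; have lt_x := ltn_trans lt_xy lt_y.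
  by rewrite (nthB (Ordinal lt_x)) (nthB (Ordinal lt_y)) lt_t.
- by move=> x lt_x; rewrite ltB // mem_nth // szB.
have n_gt0 : 0 < n by apply: leq_ltn_trans (leq0n _) (ltB (nth 0 (Bs f) 0) _); rewrite mem_nth ?szB.
have condE x : x <= k ->
  [&& (1 <= x < k) ==> (sorted_letter t f x.+1 == (sorted_letter t f x).+1),
      (x == 0 :> nat) ==> (sorted_letter t f 1 == 1)
    & (x == k :> nat) ==> (sorted_letter t f k == n)] =
  [&& (0 < x < k) ==> (nth 0 (Bs f) x == (nth 0 (Bs f) x.-1).+1),
      (x == 0) ==> (nth 0 (Bs f) 0 == 0) & (x == k) ==> (nth 0 (Bs f) k.-1 == n.-1)].
  move=> le_x; congr [&& _, _ & _].
  - by case: andP => //= -[x_gt0 lt_x]; rewrite !sL ?x_gt0 //.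
  - by rewrite sL ?k_gt0.
  by rewrite sL ?k_gt0 ?leqnn // -(eqSS _ n.-1) prednK.
have cntE v : v \notin Bs f -> k - count (ltn v) (Bs f) = count (ltn^~ v) (Bs f).
  move=> nv; rewrite -szB -(count_predC (ltn v) (Bs f)) addKn; apply: eq_in_count => a aB /=.
  by rewrite -leqNgt leq_eqVlt; case: eqP => // E; move: nv; rewrite -E aB.
apply/forallP/allP => [adj v|gp x].
  rewrite mem_iota add0n /= => lt_v; case: (boolP (v \in Bs f)) => //= nv.
  rewrite cntE //; apply: H1 => // x le_x cx; rewrite -condE //.
  have := adj (Ordinal (le_x : x < k.+1)); rewrite -constrained_ord /= cx /=.
  by [].
apply/implyP => xX; rewrite condE; last by rewrite -ltnS.
apply: H2; rewrite ?constrained_ord //; last by rewrite -ltnS.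
move=> v lt_v nv; rewrite -cntE //; have := gp v; rewrite mem_iota lt_v => /(_ isT).
by rewrite (negPf nv).
Qed.

(** [Phi] is a bijection from the hits onto the masks counted by the recurrence. For [k > n] both
    sides vanish whatever [rk] is, which allows the program to leave the ranks uncomputed in that
    case. *)
Lemma hits_count_hits rk :
  (k <= n -> forall i, i < k -> rk i = pattern_rank i) ->
  hits p X t =
  count_hits k rk (fun i => constrained (k - i)) satisfiable [::] (inv_word t).
Proof.
move=> rkE; rewrite count_hits_masks /hits.
set G := (fun m : seq bool => _).
have szW : size (inv_word t) = n by rewrite size_inv_word.
case: (leqP k n) => [le_k|lt_n]; last first.
  rewrite (@eq_in_count _ _ pred0) ?count_pred0; last first.
    move=> m _; rewrite /G /= add0n [size _ == k]ltn_eqF ?andbF //.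
    apply: leq_ltn_trans lt_n; apply: leq_trans (size_subseq (mask_subseq _ _)) _.
    by rewrite szW.
  apply/eqP; rewrite cards_eq0 -subset0; apply/subsetP => f; rewrite inE => /and3P[incr _ _].
  have := leq_card f (incr_inj incr); rewrite !card_ord; lia.
have {}rkE := rkE le_k.
have GE (f : {ffun 'I_k -> 'I_n}) : increasing_positions f -> G (Phi f) = is_hit p X t f.
  move=> incr; rewrite /G /is_hit incr mask_Phi /= add0n size_map.
  case: (boolP (order_isomorphic p t f)) => iso.
    rewrite adjacency_gaps //; move: iso; rewrite iso_VU -(ranked_VU rkE incr).
    by case/andP => -> ->.
  move: iso; rewrite iso_VU -(ranked_VU rkE incr).
  by case: (ranked _ _ _ _) => //= /negPf->; rewrite andbF.
have size_Phi f : size (Phi f) = n by rewrite size_map size_rev size_map size_enum_ord.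
rewrite cardE -(size_map Phi) -size_filter szW; apply: perm_size; apply: uniq_perm.
- rewrite map_inj_in_uniq ?enum_uniq // => f g; rewrite !mem_enum !inE.
  move=> /and3P[incf _ _] /and3P[incg _ _] E.
  have codE : codom f =i codom g.
    by move=> a; have /eq_in_map := E; apply; apply: mem_W.
  have inc_sorted (h : {ffun 'I_k -> 'I_n}) : increasing_positions h ->
      sorted (fun a b : 'I_n => a < b) (codom h).
    move=> inch; rewrite codomE sorted_map; apply: sub_sorted (sorted_enum_ord k) => i j.
    by rewrite /= incr_lt.
  have cE : codom f = codom g.
    apply: (irr_sorted_eq (leT := fun a b : 'I_n => a < b)) => //.
    + by move=> b a c; apply: ltn_trans.
    + by move=> a; rewrite ltnn.
    + exact: inc_sorted.
    exact: inc_sorted.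
  apply/ffunP => i; move: cE; rewrite !codomE => /eq_in_map; apply.
  by rewrite mem_enum.
- by rewrite filter_uniq // masks_uniq.
move=> m; rewrite mem_filter mem_masks; apply/mapP/andP => [[f]|[Gm /eqP sm]].
  rewrite mem_enum inE => hf ->; rewrite size_Phi eqxx GE ?hf //.
  by case/and3P: hf.
have /and4P[_ _ /eqP + _] := Gm; rewrite add0n inv_wordW -map_mask size_map => szk.
set v := mask m W in szk.
have uv : uniq v by rewrite mask_uniq.
(* The preimage of the mask [m]: its selected positions in increasing order. They are [k] in number
   by the size test in [G]. *)
pose v' := sort (fun a b : 'I_n => a <= b) v.
have szv' : size v' = k by rewrite size_sort.
have sv' : sorted (fun a b : 'I_n => a < b) v'.
  rewrite -[sorted _ _](sorted_map (f := val) (e' := ltn)) ltn_sorted_uniq_leq map_inj_uniq; last exact: val_inj.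
  rewrite sort_uniq uv /= sorted_map; apply: sort_sorted => a b; exact: leq_total.
pose f := [ffun i : 'I_k => tnth (Tuple (introT eqP szv')) i].
have fE (i : 'I_k) a0 : f i = nth a0 v' i by rewrite ffunE (tnth_nth a0).
have codf : codom f =i v.
  move=> a; have -> : (a \in v) = (a \in v') by rewrite mem_sort.
  apply/codomP/idP.
    by case=> i ->; rewrite (fE i a) mem_nth // szv'.
  move=> av; have lt : index a v' < k by rewrite -szv' index_mem.
  by exists (Ordinal lt); rewrite (fE _ a) nth_index.
have incf : increasing_positions f.
  apply/forallP => i; apply/forallP => j; apply/implyP => lt_ij.
  rewrite (fE i (f i)) (fE j (f i)).
  apply: (sorted_ltn_nth (leT := fun a b : 'I_n => a < b)) => //; rewrite ?inE ?szv' //.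
  by move=> b a c; apply: ltn_trans.
have PhiE : Phi f = m.
  have szWn : size W = n by rewrite size_rev size_map size_enum_ord.
  apply: (eq_from_nth (x0 := false)); rewrite size_Phi // => i lt_i.
  have a0 : 'I_n by exact: Ordinal lt_i.
  rewrite (nth_map a0) ?szWn // codf in_mask // mem_W /= index_uniq ?szWn //.
by exists f => //; rewrite mem_enum inE -GE ?PhiE.
Qed.

End HitsCount.

(** * Lower bound on the running time *)

(** The number of keys of [ks] that become present in table 0 is subadditive under composition and
    at most one for a basic instruction. *)
Lemma exec_new_keys w c s T s' (ks : seq (seq nat)) : exec w c s T s' -> uniq ks ->
  count (fun key => ~~ tabs s 0 key && tabs s' 0 key) ks <= T.
Proof.
have no_key (t : nat -> seq nat -> option nat) : count (fun key => ~~ t 0 key && t 0 key) ks <= 1.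
  by rewrite (@eq_count _ _ pred0) ?count_pred0 // => key; case: (t 0 key).
move=> E uks; elim: E => //=.
- move=> {}s h rs r; set key0 := [seq _ | _ <- _].
  apply: (@leq_trans (count_mem key0 ks)); last by rewrite count_uniq_mem //; case: (_ \in _).
  apply: sub_count => key /=; rewrite /upd.
  case: (0 =P h) => [<-|_]; last by case: (tabs s 0 key).
  by case: (key =P key0) => // _; case: (tabs s 0 key).
- move=> c1 c2 s1 s2 s3 T1 T2 _ IH1 _ IH2.
  (* A key that is new after both commands is new after the first or is added by the second. *)
  apply: leq_trans (leq_add IH1 IH2); rewrite -count_predUI.
  apply: leq_trans (leq_addr _ _); apply: sub_count => key /=.
  by case: (tabs s1 0 key) => //=; case: (tabs s2 0 key).
- by move=> r c1 c2 s1 s2 T1 _ _ IH; apply: leqW.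
- by move=> r c1 c2 s1 s2 T1 _ _ IH; apply: leqW.
move=> r c1 s1 s2 s3 T1 T2 _ _ IH1 _ IH2; apply: leqW.
apply: leq_trans (leq_add IH1 IH2); rewrite -count_predUI.
apply: leq_trans (leq_addr _ _); apply: sub_count => key /=.
by case: (tabs s1 0 key) => //=; case: (tabs s2 0 key).
Qed.

(** * The program *)

(* Scalars: 0-3 input, 4 the constant one, 5 blocks per word, 6 index and 7
   guard of the preliminary loops, 11 the value satisfiable, 12 the mask of the
   available positions, 13 those not yet used, 14 guard of the main loop, 15
   index, 16 letter, 17 mask, 18 accumulated count and 19 guard of the scan, 21 a
   position, 22 length plus one, 24 a bit.
   Vectors: 0 head and 1 tail of the queue, 2 remaining suffix, 3 prefix with
   decreased letters, 4 deleted word, 5 block, 6 new word.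
   Tables: 0 counts of hits, 1 last position, 2 available positions, 4 skipped
   counts, 5 pattern ranks, 6 inverse of the pattern; vector tables: 10 blocks,
   11 successors in the queue. *)

(** [HConst 30 0] plays the part of the empty command. *)
Definition hseq (cs : seq hcmd) : hcmd := foldr HSeq (HConst 30 0) cs.

(** For [k = 0] there are no pattern letters, so cell 0 holds the only bit of [X], and [satisfiable]
    is its negation. *)
Definition init_scalars : hcmd := hseq
  [:: HConst 4 1; HBin Div 5 3 2;
      HIf 1 (HConst 11 1) (hseq [:: HRead 8 1; HBin Defs.Sub 11 4 8]);
      HConst 6 0; HBin Lt 7 6 0].

Definition block_index : hcmd := hseq
  [:: HBin Div 22 6 5; HBin Mod 23 6 5; HBin Mul 23 2 23; HBin Shl 24 4 23].

Definition block_store : hcmd := hseq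
  [:: VInsert 10 [:: Scal 6] 5; HBin Add 6 6 4; HBin Lt 7 6 0].

Definition block_loop : hcmd :=
  HWhile 7 (HSeq block_index (HSeq (VHot 5 22 24) block_store)).

Definition inverse_body : hcmd := hseq
  [:: HRead 8 6; HInsert 6 [:: Scal 8] 6; HBin Add 6 6 4; HBin Lt 7 6 1].

(** [k - i] is the letter at index [i] of the inverse word and table 6 gives its position. The rank
    is the number of bits below this position in the mask of the positions already met. *)
Definition rank_body : hcmd := hseq
  [:: HBin Defs.Sub 8 1 6; HLookup 6 [:: Scal 8] 20 9; HBin Shl 24 4 9;
      HBin Mod 10 17 24; HUn Popcount 10 10; HInsert 5 [:: Scal 6] 10;
      HBin Add 17 17 24; HBin Add 6 6 4; HBin Lt 7 6 1].

Definition inverse_init : hcmd := hseq [:: HConst 6 0; HBin Lt 7 6 1].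

Definition rank_init : hcmd := hseq [:: HConst 6 0; HConst 17 0; HBin Lt 7 6 1].

Definition pattern_loops : hcmd :=
  HSeq inverse_init (HSeq (HWhile 7 inverse_body)
    (HSeq rank_init (HWhile 7 rank_body))).

Definition queue_init : hcmd := hseq
  [:: HBin Shl 12 4 0; HBin Defs.Sub 12 12 4; HInsert 2 [:: Vect 0] 12; HConst 14 1].

(** The length of the word is recovered as [n] minus the number of available positions. [And] of a
    vector with itself copies it and [Lt] of a vector with itself gives zero. *)
Definition scan_init : hcmd := hseq
  [:: HLookup 2 [:: Vect 0] 20 12; HUn Popcount 16 12; HBin Defs.Sub 16 0 16;
      HConst 15 0; HConst 17 0; HConst 18 0; HConst 19 1;
      VBin And 2 (Vect 0) (Vect 0); VBin Lt 3 (Vect 0) (Vect 0)].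

Definition scan_lookup : hcmd := hseq
  [:: HInsert 4 [:: Vect 0; Scal 15] 18; HLookup 1 [:: Vect 2] 20 21].

(** In round [y] the bit of [k - y] in [X] is read at address [k + k - y], behind the [k] letters of
    the pattern. *)
Definition scan_delete : hcmd := hseq
  [:: VLookup 10 [:: Scal 21] 20 5; VBin Mul 5 (Vect 5) (Scal 16);
      VBin Defs.Sub 2 (Vect 2) (Vect 5); VBin Add 4 (Vect 2) (Vect 3);
      HBin Add 8 1 1; HBin Defs.Sub 8 8 15; HRead 8 8].

Definition scan_count : hcmd := hseq
  [:: HLookup 0 [:: Vect 4] 20 9; HLookup 4 [:: Vect 4; Scal 15] 20 10;
      HBin Add 18 18 9; HBin Defs.Sub 18 18 10].

Definition scan_next : hcmd := hseq
  [:: HBin Shl 24 4 21; HBin Mod 9 17 24; HUn Popcount 9 9;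
      HLookup 5 [:: Scal 15] 20 10; HBin Eq 9 9 10; HBin Lt 10 15 1;
      HBin Mul 19 9 10; HBin Add 17 17 24; HBin Add 15 15 4;
      HBin Defs.Sub 16 16 4; VLookup 10 [:: Scal 21] 20 5;
      VBin Mul 5 (Vect 5) (Scal 16); VBin Add 3 (Vect 3) (Vect 5)].

Definition scan_stop : hcmd := hseq
  [:: HBin Eq 9 15 1; HBin Mul 9 9 11; HBin Add 18 18 9; HConst 19 0].

Definition scan_body : hcmd :=
  HSeq scan_lookup
    (HIf 20 (HSeq scan_delete (HSeq (HIf 8 (HConst 30 0) scan_count) scan_next))
            scan_stop).

Definition spawn_init : hcmd := hseq
  [:: HInsert 0 [:: Vect 0] 18; HUn Popcount 22 12; HBin Defs.Sub 22 0 22;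
      HBin Add 22 22 4; HBin And 13 12 12].

Definition spawn_body : hcmd := hseq
  [:: HBin Defs.Sub 8 13 4; HUn Popcount 8 8; HBin Add 8 8 4; HUn Popcount 9 13;
      HBin Defs.Sub 21 8 9; HBin Shl 24 4 21; HBin Defs.Sub 13 13 24;
      VLookup 10 [:: Scal 21] 20 5; VBin Mul 5 (Vect 5) (Scal 22);
      VBin Add 6 (Vect 0) (Vect 5); HInsert 1 [:: Vect 6] 21;
      HBin Defs.Sub 9 12 24; HInsert 2 [:: Vect 6] 9; VInsert 11 [:: Vect 1] 6;
      VBin And 1 (Vect 6) (Vect 6)].

Definition advance : hcmd := hseq
  [:: VLookup 11 [:: Vect 0] 14 4; VBin And 0 (Vect 4) (Vect 4)].

Definition main_body : hcmd :=
  HSeq scan_init (HSeq (HWhile 19 scan_body)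
    (HSeq spawn_init (HSeq (HWhile 13 spawn_body) advance))).

Definition hits_program : hcmd :=
  HSeq init_scalars (HSeq block_loop
    (HSeq (HSeq (HBin Lt 8 0 1) (HIf 8 (HConst 30 0) pattern_loops))
      (HSeq queue_init (HWhile 14 main_body)))).

(** * Word arithmetic *)

Arguments eval_binop : simpl never.
Arguments eval_unop : simpl never.
Arguments keyval : simpl never.
Arguments vec : simpl never.
Arguments tupd : simpl never.
Arguments vupd _ _ _ _ _ _ /.
Arguments upd _ _ _ _ _ _ /.

Lemma evalAdd w x y : x + y < 2 ^ w -> eval_binop w Add x y = x + y.
Proof. exact: modn_small. Qed.

Lemma evalSub w x y : y <= x -> x < 2 ^ w -> eval_binop w Defs.Sub x y = x - y.
Proof.
move=> le_yx lt_x; rewrite /eval_binop addnC -addnBA // addnC modnDr modn_small //.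
by apply: leq_ltn_trans lt_x; rewrite leq_subr.
Qed.

Lemma evalMul w x y : x * y < 2 ^ w -> eval_binop w Mul x y = x * y.
Proof. exact: modn_small. Qed.

Lemma evalShl w x : x < w -> eval_binop w Shl 1 x = 2 ^ x.
Proof. by move=> lt_x; rewrite /eval_binop mul1n modn_small // ltn_exp2l. Qed.

Lemma evalLt w x y : eval_binop w Lt x y = (x < y).
Proof. by []. Qed.

Lemma evalMod w x y : eval_binop w Mod x y = x %% y.
Proof. by []. Qed.

Lemma evalEq w x y : eval_binop w Eq x y = (x == y).
Proof. by []. Qed.

Lemma evalAnd w x : eval_binop w And x x = x.
Proof. exact: Nat.land_diag. Qed.

(** The intermediate sum may overflow a word; modular subtraction still gives the right result, as
    only the final value is known to be small. *)
Lemma evalAddSub w x y z : x + y < 2 ^ w -> z < 2 ^ w ->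
  eval_binop w Defs.Sub (eval_binop w Add x (z + y)) z = x + y.
Proof.
move=> lt_xy lt_z; rewrite /eval_binop -addnBA ?(ltnW lt_z) // modnDml.
have -> : x + (z + y) + (2 ^ w - z) = x + y + 2 ^ w by lia.
by rewrite modnDr modn_small.
Qed.

Lemma tupd_same f h key d g j : j < d -> tupd f h key d g (h + 2 * j) key = Some (g j).
Proof. by move=> lt_j; rewrite /tupd leq_addr addKn mul2n odd_double doubleK lt_j eqxx. Qed.

Lemma tupd_key f h key d g h' key' : key' != key -> tupd f h key d g h' key' = f h' key'.
Proof. by move=> /negPf ne; rewrite /tupd ne !andbF. Qed.

Lemma tupd_tab f h key d g h' key' : (h' < h) || odd (h' - h) ->
  tupd f h key d g h' key' = f h' key'.
Proof. by rewrite /tupd ltnNge; case: (h <= h') => //= ->. Qed.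

(** Block tables have even numbers and successor tables odd ones, so linking a new word into the
    queue leaves the blocks intact. *)
Lemma odd_block_tab j : (10 + 2 * j < 11) || odd (10 + 2 * j - 11).
Proof.
case: j => [//|j]; apply/orP; right.
by rewrite (_ : 10 + 2 * j.+1 - 11 = (2 * j).+1) ?oddS ?oddM //; lia.
Qed.

Section KeyValues.

Variable D : nat.

Lemma keyval_vect s v : keyval D s [:: Vect v] = vec D s v.
Proof. by rewrite /keyval /= cats0. Qed.

Lemma keyval_scal s r : keyval D s [:: Scal r] = [:: sc s r].
Proof. by []. Qed.

Lemma keyval_vect_scal s v r : keyval D s [:: Vect v; Scal r] = rcons (vec D s v) (sc s r).
Proof. by rewrite /keyval /= -cats1. Qed.

Lemma vec_key b w s v u : (forall j, j < D -> ve s v j = enc b w j u) ->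
  vec D s v = key D b w u.
Proof. by move=> H; apply/eq_in_map => j; rewrite mem_iota => /H. Qed.

End KeyValues.

Lemma hsem_cons D w c cs s :
  hsem D w (hseq (c :: cs)) s = hsem D w (hseq cs) (hsem D w c s).
Proof. by []. Qed.

Lemma hsem_seq D w c1 c2 s :
  hsem D w (HSeq c1 c2) s = hsem D w c2 (hsem D w c1 s).
Proof. by []. Qed.

Lemma hsem_if D w r c1 c2 s : hsem D w (HIf r c1 c2) s =
  if sc s r != 0 then hsem D w c1 s else hsem D w c2 s.
Proof. by []. Qed.

Definition put_vec D s v g := set_ve s (vupd (ve s) v D g).

Definition put_tab s h key x :=
  set_ta s (upd (ta s) h (upd (ta s h) key (Some x))).

Definition put_vtab D s h key g := set_ta s (tupd (ta s) h key D g).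

(* Runs the first command of a straight-line program, naming the values that it
   computes. *)
Ltac hstep E :=
  match goal with
  | |- context [hsem ?D ?w (hseq (?c :: ?cs)) ?s] => rewrite (hsem_cons D w c cs s)
  | _ => idtac
  end;
  match goal with
  | |- context [hsem ?D ?w (HConst ?r ?c) ?s] =>
      let x := fresh "x" in
      change (hsem D w (HConst r c) s) with (set_sc s r (c %% 2 ^ w));
      remember (c %% 2 ^ w) as x eqn:E
  | |- context [hsem ?D ?w (HUn ?o ?r ?a) ?s] =>
      let x := fresh "x" in
      change (hsem D w (HUn o r a) s) with (set_sc s r (eval_unop w o (sc s a)));
      remember (eval_unop w o (sc s a)) as x eqn:E; simpl in E
  | |- context [hsem ?D ?w (HBin ?o ?r ?a ?b) ?s] =>
      let x := fresh "x" in
      change (hsem D w (HBin o r a b) s)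
        with (set_sc s r (eval_binop w o (sc s a) (sc s b)));
      remember (eval_binop w o (sc s a) (sc s b)) as x eqn:E; simpl in E
  | |- context [hsem ?D ?w (HRead ?r ?a) ?s] =>
      let x := fresh "x" in
      change (hsem D w (HRead r a) s) with (set_sc s r (me s (sc s a)));
      remember (me s (sc s a)) as x eqn:E; simpl in E
  | |- context [hsem ?D ?w (HInsert ?h ?ks ?r) ?s] =>
      let key := fresh "key" in
      let x := eval simpl in (sc s r) in
      change (hsem D w (HInsert h ks r) s) with (put_tab s h (keyval D s ks) x);
      remember (keyval D s ks) as key eqn:E
  | |- context [hsem ?D ?w (HLookup ?h ?ks ?f ?r) ?s] =>
      let res := fresh "res" in
      change (hsem D w (HLookup h ks f r) s)
        with (set_sc (set_sc s f (isSome (ta s h (keyval D s ks)))) r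
               (odflt 0 (ta s h (keyval D s ks))));
      remember (ta s h (keyval D s ks)) as res eqn:E
  | |- context [hsem ?D ?w (VBin ?o ?v ?a ?b) ?s] =>
      let g := fresh "g" in
      change (hsem D w (VBin o v a b) s)
        with (put_vec D s v (fun j => eval_binop w o (opval s j a) (opval s j b)));
      set g := (fun j => eval_binop w o (opval s j a) (opval s j b));
      have E : forall j, j < D -> g j = eval_binop w o (opval s j a) (opval s j b)
        by [];
      clearbody g; simpl in E
  | |- context [hsem ?D ?w (VLookup ?h ?ks ?f ?v) ?s] =>
      let g := fresh "g" in let x := fresh "x" in
      change (hsem D w (VLookup h ks f v) s)
        with (set_sc (put_vec D s v
            (fun j => odflt 0 (ta s (h + 2 * j) (keyval D s ks))))
          f (isSome (ta s (h + 2 * D.-1) (keyval D s ks))));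
      set g := (fun j => odflt 0 (ta s (h + 2 * j) (keyval D s ks)));
      set x := isSome (ta s (h + 2 * D.-1) (keyval D s ks));
      have E : (forall j, j < D -> g j = odflt 0 (ta s (h + 2 * j) (keyval D s ks))) /\
               x = isSome (ta s (h + 2 * D.-1) (keyval D s ks))
        by [];
      clearbody g x
  | |- context [hsem ?D ?w (VInsert ?h ?ks ?v) ?s] =>
      let key := fresh "key" in
      change (hsem D w (VInsert h ks v) s)
        with (put_vtab D s h (keyval D s ks) (ve s v));
      remember (keyval D s ks) as key eqn:E
  | |- context [hsem ?D ?w (HIf ?r ?c1 ?c2) ?s] =>
      change (hsem D w (HIf r c1 c2) s)
        with (if sc s r != 0 then hsem D w c1 s else hsem D w c2 s)
  | |- context [hsem ?D ?w (hseq [::]) ?s] =>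
      change (hsem D w (hseq [::]) s) with (set_sc s 30 (0 %% 2 ^ w))
  end.

(** * The breadth-first queue *)

Section Created.

Variable n : nat.

Let L := words n.

(* The number of words in the queue once the first i words have been expanded. *)
Definition created (i : nat) : nat :=
  (size (flatten [seq children n u | u <- take i L])).+1.

Lemma words_created i : L =
  ([::] :: flatten [seq children n u | u <- take i L]) ++
  flatten [seq children n u | u <- drop i L].
Proof. by rewrite /L {1}words_eq cat_cons -flatten_cat -map_cat cat_take_drop. Qed.

Lemma created_le i : created i <= size L.
Proof. by rewrite [in leqRHS](words_created i) size_cat leq_addr. Qed.

Lemma createdS i : i < size L ->
  created i.+1 = created i + size (avail n (nth [::] L i)).
Proof.
move=> lt_i; rewrite /created (take_nth [::] lt_i) map_rcons -cats1 flatten_cat.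
by rewrite size_cat /= cats0 size_map addSn.
Qed.

Lemma nth_created i y : i < size L -> y < size (avail n (nth [::] L i)) ->
  nth [::] L (created i + y) = nth 0 (avail n (nth [::] L i)) y :: nth [::] L i.
Proof.
move=> lt_i lt_y; rewrite [X in nth _ X _](words_created i) nth_cat.
rewrite -[size (_ :: _)]/(created i) ltnNge leq_addr /= addKn.
rewrite (drop_nth [::] lt_i) /= nth_cat size_map lt_y.
by rewrite (nth_map 0).
Qed.

(** The queue never runs empty before the end. Otherwise the word of index [created n i] would be a
    child of a word of index at least [i], but a parent is shorter and precedes its child. *)
Lemma created_gt i : i < size L -> i < created i.
Proof.
move=> lt_i; rewrite ltnNge; apply/negP => le_c.
have lt_c : created i < size L by apply: leq_ltn_trans lt_i.
have : nth [::] L (created i) \in flatten [seq children n u | u <- drop i L].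
  rewrite [X in nth _ X _](words_created i) nth_cat -[size (_ :: _)]/(created i).
  rewrite ltnn subnn mem_nth //.
  have E := congr1 size (words_created i); rewrite size_cat -[size (_ :: _)]/(created i) in E.
  by move: lt_c; rewrite E -{1}[created i]addn0 ltn_add2l.
set v := nth _ _ _ => /flatten_mapP[u udrop /mapP[a a_av Ev]].
have vL : v \in words n by rewrite mem_nth.
have uL : u \in L by apply: mem_drop udrop.
have lt_u : index u (words n) < index v (words n).
  by apply: index_shorter => //; [rewrite -mem_words | rewrite Ev].
rewrite /v index_uniq ?words_uniq // in lt_u.
have : index u L >= i.
  have := words_uniq n; rewrite -/L -{1}(cat_take_drop i L) cat_uniq => /and3P[_ /hasPn H _].
  have nu : u \notin take i L by apply: H.
  rewrite -{1}(cat_take_drop i L) index_cat (negPf nu) size_takel ?(ltnW lt_i) //.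
  exact: leq_addr.
by rewrite leqNgt (leq_trans lt_u le_c).
Qed.

Lemma created_total : created (size L) = size L.
Proof. by rewrite [in RHS](words_created (size L)) drop_size cats0. Qed.

Lemma size_words_le : size L <= 3 * n`!.
Proof.
apply: leq_trans (sum_size_levels n).
rewrite /L /words size_flatten /shape -map_comp sumnE big_map.
by rewrite -[iota 0 n.+1]/(index_iota 0 n.+1) big_mkord.
Qed.

End Created.

(** * Verification of the program *)

Section Verification.

Variables (D k n b w : nat) (p : 'S_k) (X : {set 'I_k.+1}).
Hypotheses (D_gt0 : 0 < D) (fits : perm_fits D n b w).
Hypothesis mem_fits : size (input_mem p X) <= 2 ^ w.

Let L := words n.
Let mem0 := nth 0 (input_mem p X).
(** The pattern ranks as the program sees them: table 5 is filled only if [k <= n], and a missing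
    entry is read as 0. *)
Let rk i := if (k <= n) && (i < k) then pattern_rank p i else 0.
Let fb i := constrained X (k - i).
Let z := satisfiable X.
Let hkey := key D b w.
Let henc := enc b w.

(** * Invariants of the preliminary loops *)

Record static (s : hstate) : Prop := Static {
  static_n : sc s 0 = n;
  static_k : sc s 1 = k;
  static_one : sc s 4 = 1;
  static_sat : sc s 11 = z;
  static_mem : me s = mem0
}.

Definition block_tabs (m : nat) (t : nat -> seq nat -> option nat) : Prop :=
  forall j a, j < D -> a < m -> t (10 + 2 * j) [:: a] = Some (block b w j a).

Definition rank_tab (t : nat -> seq nat -> option nat) : Prop :=
  forall i, odflt 0 (t 5 [:: i]) = rk i.

Lemma n_lt_w : n < w.
Proof. by have /and4P[] := fits. Qed.

Lemma w_lt : w < 2 ^ w.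
Proof. exact: ltn_expl. Qed.

Lemma w_gt0 : 0 < w.
Proof. exact: leq_ltn_trans (leq0n n) n_lt_w. Qed.

Lemma pow_gt1 : 1 < 2 ^ w.
Proof. by rewrite -{1}(expn0 2) ltn_exp2l // w_gt0. Qed.

Lemma mod1 : 1 %% 2 ^ w = 1.
Proof. by rewrite modn_small // pow_gt1. Qed.

Lemma size_pattern_letters : size [seq (p i).+1 | i <- enum 'I_k] = k.
Proof. by rewrite size_map size_enum_ord. Qed.

(** The memory hypothesis amounts to [2 * k + 1 <= 2 ^ w], which makes the addresses formed in the
    scan words. *)
Lemma k_lt : k + k < 2 ^ w.
Proof.
apply: leq_trans mem_fits; rewrite /input_mem size_cat size_pattern_letters.
by rewrite [size _](_ : _ = k.+1) ?addnS // size_map size_enum_ord.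
Qed.

Lemma mem_letter (i : 'I_k) : mem0 i = (p i).+1.
Proof.
rewrite /mem0 /input_mem nth_cat size_pattern_letters ltn_ord.
by rewrite (nth_map i) ?size_enum_ord // nth_ord_enum.
Qed.

Lemma mem_constrained x : x <= k -> mem0 (k + x) = constrained X x.
Proof.
move=> le_x; rewrite /mem0 /input_mem nth_cat size_pattern_letters ltnNge leq_addr addKn.
have lt_x : x < size (enum 'I_k.+1) by rewrite size_enum_ord.
rewrite /constrained (nth_map ord0 0 (fun x : 'I_k.+1 => nat_of_bool (x \in X)) lt_x).
by rewrite (nth_map ord0 false (fun x : 'I_k.+1 => x \in X) lt_x).
Qed.

Definition start : hstate :=
  HState (nth 0 [:: n; k; b; w]) (fun _ _ => 0) mem0 (fun _ _ => None).

Lemma conc_start : conc start = input_state p X n b w.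
Proof.
rewrite /conc /input_state /start /=; congr State.
apply: functional_extensionality => r; case: ltnP => // le_r.
by rewrite nth_default //; apply: leq_trans le_r.
Qed.

Definition blank (s : hstate) : Prop :=
  [/\ forall v j, v < 2 -> ve s v j = 0,
      forall h key, h < 5 -> ta s h key = None
    & forall j key, ta s (11 + 2 * j) key = None].

Definition block_inv (a : nat) (s : hstate) : Prop :=
  [/\ static s, sc s 2 = b, sc s 5 = w %/ b, sc s 6 = a & sc s 7 = (a < n)] /\
  [/\ blank s, block_tabs a (ta s) & forall h key, h < 10 -> ta s h key = None].

Lemma init_scalars_inv : block_inv 0 (hsem D w init_scalars start).
Proof.
rewrite /init_scalars.
have Esat : forall c, c = nat_of_bool (constrained X 0) -> k = 0 ->
   eval_binop w Defs.Sub 1 c = z.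
  move=> c -> k0; rewrite /z /satisfiable (introT eqP k0) /=.
  by rewrite evalSub ?pow_gt1 //; case: constrained.
have Emem : k = 0 -> mem0 k = nat_of_bool (constrained X 0).
  by move=> k0; have := mem_constrained (leq0n k); rewrite addn0.
have Ez : k != 0 -> z = 1 :> nat by rewrite /z /satisfiable => /negPf->.
hstep E1; hstep E2; hstep E3.
rewrite mod1 in E1; rewrite [sc _ 1]/=.
case: ifPn => k0.
  rewrite [hsem D w (HConst 11 1) _]/=.
  hstep E4; hstep E5; hstep E6; rewrite mod0n in E4; rewrite E4 evalLt in E5.
  by split; split=> //=; split=> //=; rewrite ?mod1 ?Ez.
rewrite negbK in k0; move/eqP: k0 => k0.
set s1 := hsem D w (hseq [:: HRead 8 1; _]) _.
have -> : s1 = set_sc (set_sc (set_sc (set_sc (set_sc start 4 x) 5 x0) 8 (mem0 k)) 11 z)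
                      30 (0 %% 2 ^ w).
  rewrite /s1; hstep E3; hstep E4; hstep E5; rewrite E1 E3 Esat ?Emem // in E4.
  by rewrite E3 E4.
hstep E5; hstep E6; hstep E7; rewrite mod0n in E5; rewrite E5 evalLt in E6.
by split; split=> //=; split.
Qed.

Lemma block_step a s : a < n -> block_inv a s ->
  sc s 7 != 0 /\
  hoare D w (HSeq block_index (HSeq (VHot 5 22 24) block_store)) s
    (hsize D block_index + (3 * D + 2 + hsize D block_store)) (block_inv a.+1).
Proof.
move=> lt_a [[st Eb Eq Ea Eg] [bl bt lo]]; split; first by rewrite Eg lt_a.
have lt_aw : a < 2 ^ w by apply: ltn_trans lt_a (ltn_trans n_lt_w w_lt).
have /and4P[lt_n le_b leD _] := fits.
have b_gt0 : 0 < b by case: (b) lt_n => //; rewrite expn0; lia.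
have q_gt0 : 0 < w %/ b by rewrite divn_gt0.
apply: hoare_seq; apply: hoare_hsem => //.
set q := w %/ b in q_gt0 Eq *.
have lt_sh : b * (a %% q) < w.
  apply: (@leq_trans (b * q)); first by rewrite ltn_pmul2l // ltn_mod.
  by rewrite mulnC leq_trunc_div.
pose s1 := hsem D w block_index s.
have [st1 E22 E24 [Eb1 Eq1 Ea1] [bl1 bt1 lo1]] : [/\ static s1, sc s1 22 = a %/ q,
   sc s1 24 = 2 ^ (b * (a %% q)),
    [/\ sc s1 2 = b, sc s1 5 = q & sc s1 6 = a]
   & [/\ blank s1, block_tabs a (ta s1) & forall h key, h < 10 -> ta s1 h key = None]].
  case: st => Sn Sk So Ss Sm.
  rewrite /s1 /block_index; hstep E1; hstep E2; hstep E3; hstep E4; hstep E5.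
  rewrite Ea Eq in E1 E2; rewrite Eb E2 evalMul ?(ltn_trans lt_sh w_lt) // in E3.
  by rewrite So E3 evalShl // in E4.
rewrite -/s1; clearbody s1; apply: hoare_seq.
have lt_22 : sc s1 22 < 2 ^ w by rewrite E22 (leq_ltn_trans (leq_div _ _)).
exists (hot_state D s1 5 22 24); first by apply: steps_vhot => //; apply: w_gt0.
apply: hoare_hsem => //.
case: st1 => Sn Sk So Ss Sm; case: bl1 => bl1 bl2 bl3.
rewrite /block_store; hstep E1; hstep E2; hstep E3; hstep E4.
rewrite keyval_scal /= Ea1 in E1.
rewrite Ea1 So evalAdd addn1 in E2; last first.
  by apply: leq_ltn_trans lt_a (ltn_trans n_lt_w w_lt).
rewrite E2 Sn evalLt in E3.
split; split=> //=.
- split=> [v j lt_v|h key' lt_h|j key'] /=.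
  + by rewrite ifN; [apply: bl1 | lia].
  + by rewrite tupd_tab ?bl2 // (leq_trans lt_h).
  + by rewrite tupd_tab ?bl3 //; apply/orP; right; lia.
- move=> j a' lt_j; rewrite ltnS leq_eqVlt => /orP[/eqP->|lt_a'].
    rewrite E1 tupd_same //= lt_j E22 E24 /block -/q eq_sym; congr Some.
  rewrite tupd_key ?bt1 // E1; apply/eqP => -[E]; lia.
by move=> h key' lt_h; rewrite tupd_tab ?lo1 ?lt_h.
Qed.

Definition prepared (s : hstate) : Prop :=
  [/\ static s, blank s & block_tabs n (ta s)].

Definition inverse_inv (i : nat) (s : hstate) : Prop :=
  [/\ prepared s, sc s 6 = i, sc s 7 = (i < k), forall key, ta s 5 key = None
    & forall x : 'I_k, x < i -> ta s 6 [:: (p x).+1] = Some (val x)].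

Lemma inverse_step i s : k <= n -> i < k -> inverse_inv i s ->
  sc s 7 != 0 /\
  hoare D w inverse_body s (hsize D inverse_body) (inverse_inv i.+1).
Proof.
move=> le_k lt_i [[[Sn Sk So Ss Sm] [bl1 bl2 bl3] bt] E6 E7 no5 inv].
split; first by rewrite E7 lt_i.
apply: hoare_hsem => //; rewrite /inverse_body.
hstep E1; hstep E2; hstep E3; hstep E4; hstep E5.
rewrite E6 Sm (mem_letter (Ordinal lt_i)) in E1.
rewrite keyval_scal /= E1 in E2.
rewrite E6 So evalAdd addn1 in E3; last first.
  exact: (leq_ltn_trans lt_i (leq_ltn_trans (leq_addr k k) k_lt)).
rewrite E3 Sk evalLt in E4.
split=> //=.
- split=> //=; split=> [v j lt_v|h key' lt_h|j key'] /=; first exact: bl1.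
    by rewrite ifN ?bl2 //; lia.
  exact: bl3.
move=> y; rewrite ltnS leq_eqVlt => /orP[/eqP Ex|lt_x].
  have -> : y = Ordinal lt_i by apply: val_inj.
  by rewrite E2 eqxx E6.
rewrite ifN ?inv // E2; apply/eqP => -[/val_inj/perm_inj E].
by move: lt_x; rewrite E ltnn.
Qed.

Definition rank_inv (i : nat) (s : hstate) : Prop :=
  [/\ prepared s, sc s 6 = i /\ sc s 7 = (i < k),
      sc s 17 = bitmask (take i (inv_word p)),
      forall i', ta s 5 [:: i'] = if i' < i then Some (pattern_rank p i') else None
    & forall x : 'I_k, ta s 6 [:: (p x).+1] = Some (val x)].

Lemma rank_step i s : k <= n -> i < k -> rank_inv i s ->
  sc s 7 != 0 /\ hoare D w rank_body s (hsize D rank_body) (rank_inv i.+1).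
Proof.
move=> le_k lt_i [[[Sn Sk So Ss Sm] [bl1 bl2 bl3] bt] [E6 E7] E17 t5 t6].
split; first by rewrite E7 lt_i.
have lt_kw : k < 2 ^ w by apply: leq_ltn_trans (leq_addr k k) k_lt.
set q := nth 0 (inv_word p) i.
have /andP[uQ /allP ltQ] := inv_word_is_word p.
have qQ : q \in inv_word p by rewrite mem_nth // size_inv_word.
have lt_q : q < k by apply: ltQ.
have lt_qw : q < w by apply: leq_trans lt_q (leq_trans le_k (ltnW n_lt_w)).
have lets : (p (Ordinal lt_q)).+1 = k - i.
  rewrite -letter_inv_word /letter /= qQ index_uniq ?size_inv_word //.
apply: hoare_hsem => //; rewrite /rank_body.
hstep E1; hstep E2; hstep E3; hstep E4; hstep E5; hstep E8; hstep E9; hstep E10;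
  hstep E11; hstep E12.
rewrite Sk E6 evalSub ?(ltnW lt_i) // -lets in E1.
rewrite keyval_scal /= E1 t6 /= in E2; rewrite E2 /= So evalShl // in E3.
have ut : uniq (take i (inv_word p)) by rewrite take_uniq.
have lt_t : all (ltn^~ w) (take i (inv_word p)).
  apply/allP => a /mem_take /ltQ /= lt_a.
  exact: leq_trans lt_a (leq_trans le_k (ltnW n_lt_w)).
rewrite E3 E17 evalMod bitmask_mod // in E4.
rewrite E4 popcount_bitmask ?filter_uniq // in E5; last first.
  by apply/allP => a; rewrite mem_filter => /andP[_ /(allP lt_t)].
rewrite keyval_scal /= E6 in E8.
have bmS : bitmask (take i (inv_word p)) + 2 ^ q = bitmask (take i.+1 (inv_word p)).
  rewrite (take_nth 0) ?size_inv_word // -/q -cats1 bitmask_cat bitmask_cons.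
  by rewrite /bitmask big_nil addn0.
have lt_bm : bitmask (take i (inv_word p)) + 2 ^ q < 2 ^ w.
  rewrite bmS bitmask_lt ?take_uniq //; apply/allP => a /mem_take /ltQ /= lt_a.
  exact: leq_trans lt_a (leq_trans le_k (ltnW n_lt_w)).
rewrite E17 E3 evalAdd // bmS in E9.
rewrite E6 So evalAdd addn1 in E10; last exact: (leq_ltn_trans lt_i lt_kw).
rewrite E10 Sk evalLt in E11.
split=> //=.
- split=> //=; split=> [v j lt_v|h key' lt_h|j key'] /=; first exact: bl1.
    by rewrite ifN ?bl2 //; lia.
  exact: bl3.
- move=> i'; rewrite E8 eqseq_cons andbT; case: eqP => [->|ne].
    by rewrite ltnSn E5 size_filter.
  by rewrite t5 ltnS [i' <= i]leq_eqVlt; case: eqP.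
Qed.

Definition ready (s : hstate) : Prop := prepared s /\ rank_tab (ta s).

Definition pattern_cost : nat :=
  hsize D inverse_init + hsize D rank_init + hsize D inverse_body +
  hsize D rank_body + 6.

(** If [k > n] the loops are skipped and the empty table 5 represents the zero ranks. If [k <= n]
    the loops cost time linear in [n], and positions of the pattern are below [w], so sets of them
    fit in one word. *)
Lemma pattern_ready s : block_inv n s ->
  hoare D w (HSeq (HBin Lt 8 0 1) (HIf 8 (HConst 30 0) pattern_loops)) s
    (pattern_cost * n.+1) ready.
Proof.
move=> [[[Sn Sk So Ss Sm] Eb Eq Ea Eg] [[bl1 bl2 bl3] bt lo]].
have cost : pattern_cost * n.+1 =
   1 + (pattern_cost * n.+1 - 2).+1 by rewrite /pattern_cost; nia.
rewrite cost; apply: hoare_seq; apply: hoare_hsem => //=.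
set s1 := set_sc _ _ _.
have P1 : prepared s1 by [].
have no h key : h < 10 -> ta s1 h key = None by apply: lo.
have E8 : sc s1 8 = (n < k) by rewrite /s1 /= Sn Sk.
clearbody s1; apply: hoare_if => //; rewrite E8.
  rewrite eqb0 negbK => lt_k; apply: hoare_hsem => //=.
    by rewrite /pattern_cost; nia.
  case: P1 => -[Sn1 Sk1 So1 Ss1 Sm1] [b1 b2 b3] bt1.
  by split=> // i; rewrite /= no // /rk leqNgt lt_k.
move=> /eqP; rewrite eqb0 -leqNgt => le_k.
apply: (@hoare_conseq _ _ _ _ (hsize D inverse_init + ((\sum_(i < k) (hsize D inverse_body).+1 + 1)
   + (hsize D rank_init + (\sum_(i < k) (hsize D rank_body).+1 + 1)))) _ ready); last 2 first.
- by rewrite !sum_nat_const card_ord /pattern_cost; nia.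
- by [].
apply: hoare_seq; apply: hoare_hsem => //.
set s2 := hsem _ _ _ _.
have I2 : inverse_inv 0 s2.
  case: P1 => -[Sn1 Sk1 So1 Ss1 Sm1] [b1 b2 b3] bt1.
  rewrite /s2 /inverse_init; hstep E1; hstep E2; hstep E3.
  rewrite mod0n in E1; rewrite E1 Sk1 evalLt in E2.
  by split=> //= key; apply: no.
apply: hoare_seq; apply: (hoare_conseq (hoare_while (B := fun=> hsize D inverse_body)
  (N := k) _ _ _ I2)) => //.
- by move=> i s' lt_i; apply: inverse_step.
- by move=> s' [_ _ -> _ _]; rewrite ltnn.
move=> s3 [[[Sn3 Sk3 So3 Ss3 Sm3] [c1 c2 c3] bt3] E6 E7 no5 inv].
apply: hoare_seq; apply: hoare_hsem => //.
set s4 := hsem _ _ _ _.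
have I4 : rank_inv 0 s4.
  rewrite /s4 /rank_init; hstep E1; hstep E2; hstep E3; hstep E4.
  rewrite mod0n in E1 E2; rewrite E1 Sk3 evalLt in E3.
  split=> /=.
  - by [].
  - by rewrite E3 E1 E2.
  - by rewrite E2 take0 /bitmask big_nil.
  - by move=> i'; rewrite no5.
  - by move=> y; apply: inv.
apply: (hoare_conseq (hoare_while (B := fun=> hsize D rank_body)
  (N := k) _ _ _ I4)) => //.
- by move=> i s' lt_i; apply: rank_step.
- by move=> s' [_ [_ ->] _ _ _]; rewrite ltnn.
move=> s5 [P5 _ _ t5 _]; split=> // i; rewrite t5 /rk le_k.
by case: ltnP.
Qed.

(** * The queue and the scan of one word *)

Local Notation hits_of := (count_hits k rk fb z [::]).
Local Notation skip_of := (skipped k rk fb z).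
Local Notation depth := (mdepth k rk).
Local Notation word := (nth [::] L).

(** Here [i] words have been expanded and [c] words created. The queue is a linked list: the vector
    table 11 holds under each key the key of the successor. The last position of the empty word is
    absent, which is how a scan notices the end of the word. *)
Record queue_tabs (i c : nat) (t : nat -> seq nat -> option nat) : Prop := QueueTabs {
  queue_last : forall x, x < c -> t 1 (hkey (word x)) = ohead (word x);
  queue_avail : forall x, x < c ->
    t 2 (hkey (word x)) = Some (bitmask (avail n (word x)));
  queue_next : forall x j, x < size L -> j < D -> t (11 + 2 * j) (hkey (word x)) =
    if x.+1 < c then Some (henc j (word x.+1)) else None;
  queue_hits : forall x, x < i -> t 0 (hkey (word x)) = Some (hits_of (word x));
  queue_skip : forall x y, x < i -> y <= depth (word x) ->
    t 4 (rcons (hkey (word x)) y) = Some (skip_of (word x) y)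
}.

Definition vec_enc (s : hstate) (v : nat) (u : seq nat) : Prop :=
  forall j, j < D -> ve s v j = henc j u.

Lemma vec_hkey s v u : vec_enc s v u -> vec D s v = hkey u.
Proof. exact: vec_key. Qed.

Definition main_inv (i : nat) (s : hstate) : Prop :=
  [/\ static s, block_tabs n (ta s), rank_tab (ta s)
    & queue_tabs i (created n i) (ta s)] /\
  [/\ sc s 14 = (i < size L), i < size L -> vec_enc s 0 (word i)
    & vec_enc s 1 (word (created n i).-1)].

Lemma word_is_word x : is_word n (word x).
Proof.
case: (ltnP x (size L)) => [lt_x|le_x]; last by rewrite nth_default.
by rewrite -mem_words mem_nth.
Qed.

Lemma word0 : word 0 = [::].
Proof. by rewrite /L words_eq. Qed.

Lemma hkey_inj u v : is_word n u -> is_word n v -> (hkey u == hkey v) = (u == v).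
Proof.
move=> wu wv; apply/eqP/eqP => [|->//]; exact: key_inj fits _ _ wu wv.
Qed.

Lemma hkey_word x y : x < size L -> y < size L -> (hkey (word x) == hkey (word y)) = (x == y).
Proof.
move=> lt_x lt_y; rewrite hkey_inj ?word_is_word //.
by rewrite nth_uniq // words_uniq.
Qed.

Lemma queue_ready s : ready s ->
  hoare D w queue_init s (hsize D queue_init) (main_inv 0).
Proof.
move=> [[[Sn Sk So Ss Sm] [bl1 bl2 bl3] bt] rt]; apply: hoare_hsem => //.
rewrite /queue_init; hstep E1; hstep E2; hstep E3; hstep E4; hstep E5.
rewrite Sn So evalShl ?n_lt_w // in E1.
have lt_2n : 2 ^ n < 2 ^ w by rewrite ltn_exp2l ?n_lt_w.
rewrite E1 So evalSub ?expn_gt0 // in E2.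
rewrite keyval_vect (@vec_key _ b w _ _ [::]) in E3; last by move=> j _; apply: bl1.
rewrite mod1 in E4.
have c0 : created n 0 = 1 by rewrite /created take0.
split; split=> //=.
- rewrite c0; split=> //= [[|//] _|[|//] _].
  + by rewrite word0 bl2.
  + rewrite word0 E3 eqxx E2 -bitmask_iota; congr (Some (bitmask _)).
    by rewrite /avail; apply/esym/all_filterP/allP.
- by move=> _ j lt_j; apply: bl1.
by rewrite ?c0 ?word0 => j lt_j; apply: bl1.
Qed.

Section Scan.

Variable i : nat.
Hypothesis lt_i : i < size L.

Let u := word i.

Definition scan_frame (y : nat) (s : hstate) : Prop :=
  [/\ static s, block_tabs n (ta s), rank_tab (ta s)
    & queue_tabs i (created n i) (ta s)] /\
  [/\ sc s 12 = bitmask (avail n u), vec_enc s 0 u,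
      vec_enc s 1 (word (created n i).-1)
    & forall y', y' < y -> ta s 4 (rcons (hkey u) y') = Some (skip_of u y')].

(** The scan makes [(depth u).+1] rounds. Round [depth u] meets a mismatch or the end of the word,
    adds the last summand and clears the guard; from then on register 18 holds the full count. *)
Definition scan_inv (y : nat) (s : hstate) : Prop :=
  scan_frame y s /\
  if y <= depth u then
    [/\ sc s 15 = y, sc s 16 = size u - y, sc s 17 = bitmask (take y u),
        sc s 18 = skip_of u y & sc s 19 != 0] /\
    vec_enc s 2 (drop y u) /\ (forall j, j < D -> ve s 3 j = enc_prefix b w j u y)
  else sc s 19 = 0 /\ sc s 18 = hits_of u.

Lemma scan_frame_ext y s s' : scan_frame y s ->
  [/\ sc s' 0 = sc s 0, sc s' 1 = sc s 1, sc s' 4 = sc s 4 & sc s' 11 = sc s 11] ->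
  [/\ sc s' 12 = sc s 12, me s' = me s, ta s' = ta s, ve s' 0 = ve s 0
    & ve s' 1 = ve s 1] -> scan_frame y s'.
Proof.
case: s => c v m t; case: s' => c' v' m' t' /=.
move=> [[[/= Sn Sk So Ss Sm] bt rt qt] [/= E12 v0 v1 t4]] [/= E0 E1 E4 E11].
move=> [E12' Em Et Ev0 Ev1]; rewrite /scan_frame /= Et.
split; split=> //; first by split=> /=; rewrite ?E0 ?E1 ?E4 ?E11 ?Em.
- by rewrite E12'.
- by move=> j lt_j; rewrite /= Ev0; apply: v0.
by move=> j lt_j; rewrite /= Ev1; apply: v1.
Qed.

Lemma u_word : is_word n u.
Proof. exact: word_is_word. Qed.

Lemma subseq_word v v' : subseq v v' -> is_word n v' -> is_word n v.
Proof.
move=> sub /andP[uv /allP av]; rewrite /is_word (subseq_uniq sub uv).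
by apply/allP => a /(mem_subseq sub) /av.
Qed.

Lemma drop_word y : is_word n (drop y u).
Proof. by apply: subseq_word u_word; apply: drop_subseq. Qed.

Lemma delete_word y : is_word n (delete y u).
Proof.
apply: subseq_word u_word; rewrite /delete -{3}(cat_take_drop y u).
by apply: cat_subseq => //; rewrite -add1n -drop_drop drop_subseq.
Qed.

Lemma hits_of_lt v : is_word n v -> hits_of v < 2 ^ w.
Proof.
move=> wv; apply: leq_ltn_trans (count_hits_le _ _ _ _ _ _) _.
by rewrite ltn_exp2l // (leq_ltn_trans (size_word wv)) ?n_lt_w.
Qed.

Lemma shorter_created v : is_word n v -> size v < size u -> index v L < i.
Proof.
move=> wv lt_v; have <- : index u L = i by rewrite index_uniq ?words_uniq.
by apply: index_shorter; rewrite // mem_nth.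
Qed.

Lemma word_index v : is_word n v -> word (index v L) = v.
Proof. by move=> wv; rewrite nth_index // mem_words. Qed.

Lemma scan_lookup_spec y s : scan_inv y s -> y <= depth u ->
  let s1 := hsem D w scan_lookup s in
  [/\ scan_frame y.+1 s1, sc s1 20 = (y < size u), sc s1 21 = nth 0 u y &
  [/\ sc s1 15 = y, sc s1 16 = size u - y, sc s1 17 = bitmask (take y u)
    & sc s1 18 = skip_of u y] /\
  vec_enc s1 2 (drop y u) /\ (forall j, j < D -> ve s1 3 j = enc_prefix b w j u y)].
Proof.
move=> [[[[Sn Sk So Ss Sm] bt rt qt] [E12 v0 v1 t4]]] + le_y; rewrite le_y; cbv zeta.
move=> [[E15 E16 E17 E18 E19] [v2 v3]].
have le_yu : y <= size u := leq_trans le_y (mdepth_le _ _ _).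
rewrite /scan_lookup; hstep E1; hstep E2; hstep E3.
rewrite keyval_vect_scal (vec_hkey v0) E15 in E1.
rewrite keyval_vect (@vec_hkey _ 2 (drop y u)) // in E2.
(* The suffix is [u] itself or a shorter word. In either case it is already in the queue, and table
   1 yields its head, the next position, without decoding the key. *)
have Elast : ta s 1 (hkey (drop y u)) = ohead (drop y u).
  have wd := drop_word y.
  rewrite -{1}(word_index wd) -[in RHS](word_index wd); apply: (queue_last qt).
  apply: leq_ltn_trans (created_gt lt_i).
  case: (posnP y) => [->|y_gt0]; first by rewrite drop0 index_uniq ?words_uniq.
  case: (leqP (size u) 0) => [u0|u_gt0].
    by rewrite drop_oversize ?(leq_trans u0) // /L words_eq.
  by apply: ltnW; apply: shorter_created => //; rewrite size_drop; lia.
rewrite /= Elast in E2.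
have Eh : ohead (drop y u) = if y < size u then Some (nth 0 u y) else None.
  case: ltnP => [lt_y|le]; first by rewrite (drop_nth 0 lt_y).
  by rewrite drop_oversize.
rewrite Eh in E2.
split.
- split; split=> //=.
  + case: qt => q1 q2 q3 q4 q5; split=> //= m y0 lt_x le_y0.
    rewrite ifN ?q5 // E1 eqseq_rcons negb_and hkey_word ?(ltn_eqF lt_x) //.
    exact: ltn_trans lt_x lt_i.
  + move=> y' lt_y'; rewrite E1 eqseq_rcons eqxx /=; case: eqP => [->|ne]; first by rewrite E18.
    by apply: t4; lia.
- by rewrite /= E2; case: ltnP.
- by rewrite /= E2; case: ltnP => //= le; rewrite nth_default.
by [].
Qed.

Lemma scan_delete_spec y s : scan_frame y.+1 s -> y <= depth u -> y < size u ->
  sc s 21 = nth 0 u y -> sc s 15 = y -> sc s 16 = size u - y ->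
  vec_enc s 2 (drop y u) -> (forall j, j < D -> ve s 3 j = enc_prefix b w j u y) ->
  let s1 := hsem D w scan_delete s in
  [/\ scan_frame y.+1 s1, vec_enc s1 2 (drop y.+1 u), vec_enc s1 4 (delete y u),
     ve s1 3 = ve s 3 & sc s1 8 = fb y /\
       forall r, r \in [:: 15; 16; 17; 18; 21] -> sc s1 r = sc s r].
Proof.
move=> F le_y lt_y E21 E15 E16 v2 v3; cbv zeta.
have [[[Sn Sk So Ss Sm] bt rt qt] [E12 v0 v1 t4]] := F.
have /andP[_ /allP ltu] := u_word.
have lt_e : nth 0 u y < n by apply: ltu; rewrite mem_nth.
have le_k : y <= k by apply: (@matches_lt k rk y u (ltnW lt_y)); rewrite matches_mdepth // ltnW.
rewrite /scan_delete; hstep E1; hstep E2; hstep E3; hstep E4; hstep E5; hstep E6;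
  hstep E7; hstep E8.
have {}E1 j : j < D -> g j = block b w j (nth 0 u y).
  move=> lt_j; rewrite (proj1 E1) // keyval_scal E21 /= bt //.
have lt_enc j : j < D -> enc b w j (drop y u) < 2 ^ w.
  by move=> lt_j; apply: (enc_lt fits lt_j (drop_word y)).
have {}E2 j : j < D -> g0 j = (size u - y) * block b w j (nth 0 u y).
  move=> lt_j; rewrite E2 // lt_j E1 // E16 evalMul mulnC //.
  apply: leq_ltn_trans (lt_enc j lt_j); rewrite enc_drop //; exact: leq_addr.
have {}E3 j : j < D -> g1 j = enc b w j (drop y.+1 u).
  move=> lt_j; rewrite E3 // lt_j v2 // E2 // /henc.
  rewrite evalSub ?lt_enc //; rewrite enc_drop ?addKn //; exact: leq_addr.
have {}E4 j : j < D -> g2 j = enc b w j (delete y u).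
  move=> lt_j; rewrite E4 // lt_j E3 // v3 // evalAdd -enc_delete //.
  exact: (enc_lt fits lt_j (delete_word y)).
rewrite Sk evalAdd ?k_lt // in E5.
rewrite E5 E15 evalSub ?k_lt // in E6; last exact: leq_trans le_k (leq_addr _ _).
rewrite E6 Sm -addnBA // mem_constrained ?leq_subr // in E7.
split=> /=.
- by apply: scan_frame_ext F _ _.
- by move=> j lt_j /=; rewrite lt_j E3.
- by move=> j lt_j /=; rewrite lt_j E4.
- by [].
split; first by rewrite E7.
by move=> r; rewrite !inE => /or4P[/eqP->|/eqP->|/eqP->|/orP[] /eqP->].
Qed.

Lemma scan_count_spec y s : scan_frame y.+1 s -> y <= depth u -> y < size u ->
  sc s 15 = y -> sc s 18 = skip_of u y -> vec_enc s 4 (delete y u) -> sc s 8 = fb y ->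
  let s1 := if sc s 8 != 0 then hsem D w (HConst 30 0) s else hsem D w scan_count s in
  [/\ scan_frame y.+1 s1, ve s1 = ve s,
      sc s1 18 = skip_of u y + (if fb y then 0 else
        count_hits k rk fb z (take y u) (drop y.+1 u))
    & forall r, r \in [:: 15; 16; 17; 21] -> sc s1 r = sc s r].
Proof.
move=> F le_y lt_y E15 E18 v4 E8; cbv zeta.
have [[[Sn Sk So Ss Sm] bt rt qt] [E12 v0 v1 t4]] := F.
have mat : matches k rk y u by rewrite matches_mdepth // ltnW.
rewrite E8 eqb0 negbK; case: ifP => fby.
  split.
  - by apply: scan_frame_ext F _ _.
  - by [].
  - by rewrite addn0.
  by move=> r; rewrite !inE => /or4P[] /eqP->.
rewrite /scan_count; hstep E1; hstep E2; hstep E3; hstep E4; hstep E5.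
have wd := delete_word y.
(* The deleted word is shorter than [u], so it has been fully expanded and its counts are in the
   tables. *)
have lt_x : index (delete y u) L < i.
  by apply: shorter_created => //; rewrite size_delete //; lia.
rewrite keyval_vect (vec_hkey v4) -(word_index wd) (queue_hits qt) // word_index // in E1.
rewrite keyval_vect_scal (@vec_hkey _ 4 (delete y u)) // in E2.
(* The first [y] entries survive the deletion, so the deleted word matches up to [y] and its
   difference at [y] has been stored. *)
rewrite /= E15 -(word_index wd) (queue_skip qt) // word_index // in E2; last first.
  rewrite -matches_mdepth ?size_delete //; last by lia.
  by rewrite matches_delete.
set F1 := count_hits k rk fb z (take y u) (drop y.+1 u).
have hd := count_hits_delete fb z lt_y mat; rewrite -/F1 in hd.
have lt1 : skip_of u y + F1 < 2 ^ w.
  apply: leq_ltn_trans (hits_of_lt u_word).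
  have := count_hits_mono fb z (ltnW lt_y) mat.
  rewrite /skipped (count_hits_step k rk fb z lt_y) fby -/F1; lia.
have lt2 : skip_of (delete y u) y < 2 ^ w.
  by apply: leq_ltn_trans (hits_of_lt wd); rewrite hd leq_addr.
rewrite E3 E1 E2 E18 /= hd evalAddSub // in E4.
split.
- by apply: scan_frame_ext F _ _.
- by [].
- by [].
by move=> r; rewrite !inE => /or4P[] /eqP->.
Qed.

Lemma scan_next_spec y s : scan_frame y.+1 s -> y <= depth u -> y < size u ->
  sc s 15 = y -> sc s 16 = size u - y -> sc s 17 = bitmask (take y u) ->
  sc s 21 = nth 0 u y ->
  sc s 18 = skip_of u y + (if fb y then 0 else
        count_hits k rk fb z (take y u) (drop y.+1 u)) ->
  vec_enc s 2 (drop y.+1 u) -> (forall j, j < D -> ve s 3 j = enc_prefix b w j u y) ->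
  scan_inv y.+1 (hsem D w scan_next s).
Proof.
move=> F le_y lt_y E15 E16 E17 E21 E18 v2 v3.
have [[[Sn Sk So Ss Sm] bt rt qt] [E12 v0 v1 t4]] := F.
have mat : matches k rk y u by rewrite matches_mdepth // ltnW.
have /andP[uu /allP ltu] := u_word.
have lt_e : nth 0 u y < n by apply: ltu; rewrite mem_nth.
have ltw a : a \in u -> a < w by move/ltu/ltn_trans; apply; apply: n_lt_w.
have lt_yw : y.+1 < 2 ^ w.
  exact: leq_ltn_trans (leq_trans lt_y (size_word u_word)) (ltn_trans n_lt_w w_lt).
rewrite /scan_next; hstep E1; hstep E2; hstep E3; hstep E4; hstep E5; hstep E6;
  hstep E7; hstep E8; hstep E9; hstep E10; hstep E11; hstep E13; hstep E14; hstep E19.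
rewrite So E21 evalShl ?ltw ?mem_nth // in E1.
have ut : uniq (take y u) by rewrite take_uniq.
rewrite E17 E1 evalMod bitmask_mod // in E2.
rewrite E2 popcount_bitmask ?filter_uniq // in E3; last first.
  by apply/allP => a; rewrite mem_filter => /andP[_ /mem_take /ltw].
rewrite size_filter in E3.
rewrite E3 E4 keyval_scal /= E15 rt evalEq in E5.
rewrite E15 Sk evalLt in E6.
have ext : x4 = extends k rk (take y u) (nth 0 u y).
  rewrite E7 E5 E6 evalMul mulnb; last first.
    by apply: leq_ltn_trans pow_gt1; case: andb.
  by rewrite /extends size_takel ?(ltnW lt_y) // andbC.
have bmS : bitmask (take y u) + 2 ^ nth 0 u y = bitmask (take y.+1 u).
  rewrite (take_nth 0) // -cats1 bitmask_cat bitmask_cons.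
  by rewrite /bitmask big_nil addn0.
have lt_bm : bitmask (take y u) + 2 ^ nth 0 u y < 2 ^ w.
  by rewrite bmS bitmask_lt ?take_uniq //; apply/allP => a /mem_take /ltw.
rewrite E17 E1 evalAdd // bmS in E8.
rewrite E15 So evalAdd addn1 // in E9.
have lt_uw : size u < 2 ^ w.
  exact: leq_ltn_trans (size_word u_word) (ltn_trans n_lt_w w_lt).
rewrite E16 So evalSub ?subn_gt0 // in E10; last by apply: leq_ltn_trans lt_uw; rewrite leq_subr.
have {}E10 : x7 = size u - y.+1 by rewrite E10 -subnDA addn1.
have {}E11 j : j < D -> g j = block b w j (nth 0 u y).
  by move=> lt_j; rewrite (proj1 E11) // keyval_scal /= E21 bt.
have pre j : enc_prefix b w j u y.+1 =
    enc_prefix b w j u y + (size u - y.+1) * block b w j (nth 0 u y).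
  by rewrite /enc_prefix big_nat_recr.
(* The prefix sum is part of the key of a deleted word. At the last entry there is no next one to
   delete, but the new summand is then zero and the deletion of the current entry serves. *)
have lt_pre j : j < D -> enc_prefix b w j u y.+1 < 2 ^ w.
  move=> lt_j; case: (ltnP y.+1 (size u)) => [lt|ge].
    by apply: leq_ltn_trans (enc_lt fits lt_j (delete_word y.+1)); rewrite enc_delete // leq_addl.
  rewrite pre (_ : size u - y.+1 = 0) ?mul0n ?addn0; last by lia.
  by apply: leq_ltn_trans (enc_lt fits lt_j (delete_word y)); rewrite enc_delete // leq_addl.
have {}E13 j : j < D -> g0 j = (size u - y.+1) * block b w j (nth 0 u y).
  move=> lt_j; rewrite E13 // lt_j E11 // E10 evalMul mulnC //.
  by apply: leq_ltn_trans (lt_pre j lt_j); rewrite pre leq_addl.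
have {}E14 j : j < D -> g1 j = enc_prefix b w j u y.+1.
  by move=> lt_j; rewrite E14 // lt_j v3 // E13 // evalAdd -pre // lt_pre.
split; first by apply: scan_frame_ext F _ _.
case: ifP => [dS|dS].
  have mS : matches k rk y.+1 u by rewrite matches_mdepth.
  have extT : extends k rk (take y u) (nth 0 u y) by move: mS; rewrite matchesS => /andP[].
  split; first split=> //=.
  - by rewrite E18 (skippedS fb z lt_y mS).
  - by rewrite ext extT.
  by split=> j lt_j /=; [exact: v2 | rewrite lt_j; apply: E14].
have nS : ~~ matches k rk y.+1 u by rewrite matches_mdepth // dS.
split=> /=; last by rewrite E18 (skipped_stop fb z lt_y mat nS).
by move: nS; rewrite matchesS mat ext /= => /negPf->.
Qed.

Lemma scan_step y s : y < (depth u).+1 -> scan_inv y s ->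
  sc s 19 != 0 /\ hoare D w scan_body s (hsize D scan_body) (scan_inv y.+1).
Proof.
rewrite ltnS => le_y I; split; first by have := proj2 I; rewrite le_y => -[[]].
apply: hoare_hsem => //.
have := scan_lookup_spec I le_y; cbv zeta; set s1 := hsem D w scan_lookup s.
move=> [F1 E20 E21 [[E15 E16 E17 E18] [v2 v3]]].
rewrite /scan_body (hsem_seq D w scan_lookup) -/s1 (hsem_if D w 20).
rewrite (hsem_seq D w scan_delete) (hsem_seq D w (HIf 8 _ _)) (hsem_if D w 8).
clearbody s1; rewrite E20 eqb0 negbK; case: ltnP => lt_y.
  have := scan_delete_spec F1 le_y lt_y E21 E15 E16 v2 v3; cbv zeta.
  set s2 := hsem D w scan_delete s1; clearbody s2 => -[F2 w2 w4 w3 [E8 sE]].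
  have E15a : sc s2 15 = y by rewrite sE.
  have E18a : sc s2 18 = skip_of u y by rewrite sE.
  have := scan_count_spec F2 le_y lt_y E15a E18a w4 E8; cbv zeta.
  set s3 := (if _ then _ else _); clearbody s3 => -[F3 veE E18' sE'].
  apply: scan_next_spec => //; try by rewrite sE' // sE.
    by move=> j lt_j; rewrite veE w2.
  by move=> j lt_j; rewrite veE w3 v3.
have Ey : y = size u by apply/eqP; rewrite eqn_leq lt_y (leq_trans le_y (mdepth_le _ _ _)).
have [[[Sn Sk So Ss Sm] bt rt qt] [E12 v0 v1 t4]] := F1.
have mat : matches k rk (size u) u by rewrite matches_mdepth // -Ey.
rewrite /scan_stop; hstep E1; hstep E2; hstep E3; hstep E4; hstep E5.
rewrite mod0n in E4; rewrite E15 Sk evalEq Ey in E1.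
have lt_hits := hits_of_lt u_word.
have hE := skipped_end fb z mat.
rewrite E1 Ss evalMul mulnb in E2; last first.
  by apply: leq_ltn_trans pow_gt1; case: andb.
rewrite E18 E2 Ey evalAdd -hE // in E3.
split; first by apply: scan_frame_ext F1 _ _.
by rewrite Ey ltnNge mdepth_le.
Qed.

Lemma scan_start s : main_inv i s ->
  hoare D w scan_init s (hsize D scan_init) (scan_inv 0).
Proof.
move=> [[[Sn Sk So Ss Sm] bt rt qt] [E14 v0 v1]].
have {}v0 := v0 lt_i; apply: hoare_hsem => //.
have uw := u_word.
have lt_nw : n < 2 ^ w by apply: ltn_trans n_lt_w w_lt.
rewrite /scan_init; hstep E1; hstep E2; hstep E3; hstep E4; hstep E5; hstep E6;
  hstep E7; hstep E8; hstep E9; hstep E10.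
rewrite keyval_vect (vec_hkey v0) (queue_avail qt) ?created_gt // -/u in E1.
rewrite E1 /= popcount_bitmask ?avail_uniq ?size_avail // in E2; last first.
  by apply/allP => a; rewrite mem_avail => /andP[lt_a _]; apply: ltn_trans lt_a n_lt_w.
rewrite Sn E2 evalSub ?leq_subr // subKn ?(size_word uw) // in E3.
rewrite mod0n in E6; rewrite mod1 in E7.
have Z2 : x2 = 0 by rewrite E5.
have Z1 : x1 = 0 by rewrite E4.
split.
  by split; split=> //=; rewrite E1.
rewrite leq0n; split.
  split=> /=.
  - by [].
  - by rewrite subn0.
  - by rewrite Z2 take0 /bitmask big_nil.
  - by rewrite E6 skipped0.
  - by rewrite E7.
split=> j lt_j /=; rewrite lt_j.
  by rewrite E8 // evalAnd drop0 v0.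
by rewrite E9 // evalLt ltnn /enc_prefix big_geq.
Qed.

(** * Expansion of a word into its children *)

Let av := avail n u.
Let c := created n i.

Definition spawn_inv (y : nat) (s : hstate) : Prop :=
  [/\ static s, block_tabs n (ta s), rank_tab (ta s)
    & queue_tabs i.+1 (c + y) (ta s)] /\
  [/\ sc s 12 = bitmask av, sc s 13 = bitmask (drop y av), sc s 22 = (size u).+1,
      vec_enc s 0 u & vec_enc s 1 (word (c + y).-1)].

Lemma lt_avail a : a \in av -> a < w.
Proof. by rewrite mem_avail => /andP[lt_a _]; apply: ltn_trans lt_a n_lt_w. Qed.

Lemma spawn_start s : scan_inv (depth u).+1 s ->
  hoare D w spawn_init s (hsize D spawn_init) (spawn_inv 0).
Proof.
move=> [[[[Sn Sk So Ss Sm] bt rt qt] [E12 v0 v1 t4]]]; rewrite ltnn => -[_ E18].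
apply: hoare_hsem => //.
have uw := u_word.
have lt_nw : n < 2 ^ w by apply: ltn_trans n_lt_w w_lt.
rewrite /spawn_init; hstep E1; hstep E2; hstep E3; hstep E4; hstep E5; hstep E6.
rewrite keyval_vect (vec_hkey v0) in E1.
rewrite E12 popcount_bitmask ?avail_uniq ?size_avail // in E2; last first.
  by apply/allP => a /lt_avail.
rewrite Sn E2 evalSub ?leq_subr // subKn ?(size_word uw) // in E3.
rewrite E3 So evalAdd addn1 in E4; last first.
  exact: leq_ltn_trans (leq_ltn_trans (size_word uw) n_lt_w) w_lt.
rewrite E12 evalAnd in E5.
split; split=> //=.
- case: qt => q1 q2 q3 q4 q5; rewrite addn0; split=> //= m.
    rewrite ltnS leq_eqVlt => /orP[/eqP->|lt_m]; first by rewrite E1 eqxx E18.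
    rewrite ifN ?q4 // E1 hkey_word ?(ltn_eqF lt_m) //; exact: ltn_trans lt_m lt_i.
  move=> y; rewrite ltnS leq_eqVlt => /orP[/eqP->|lt_m] le_y; first exact: t4.
  exact: q5.
- by rewrite drop0.
by rewrite addn0.
Qed.

Lemma spawn_step y s : y < size av -> spawn_inv y s ->
  sc s 13 != 0 /\ hoare D w spawn_body s (hsize D spawn_body) (spawn_inv y.+1).
Proof.
move=> lt_y [[[Sn Sk So Ss Sm] bt rt qt] [E12 E13 E22 v0 v1]].
have uw := u_word.
set e := nth 0 av y; set rest := drop y.+1 av.
have dE : drop y av = e :: rest by rewrite (drop_nth 0 lt_y).
have eav : e \in av by rewrite mem_nth.
have [lt_e ne] : e < n /\ e \notin u by move: eav; rewrite mem_avail => /andP[].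
have lt_ew : e < w := lt_avail eav.
have udr : uniq (e :: rest) by rewrite -dE drop_uniq ?avail_uniq.
have ltdr : all (ltn^~ w) (e :: rest).
  by rewrite -dE; apply/allP => a /mem_drop /lt_avail.
have ltrest : all (ltn e) rest.
  have so : sorted ltn (drop y av).
    by apply: drop_sorted; apply: sorted_filter ltn_trans _ _ (iota_ltn_sorted 0 n).
  by move: so; rewrite dE /= path_sortedE => [/andP[]|]; last exact: ltn_trans.
have lt_bm : bitmask (e :: rest) < 2 ^ w by apply: bitmask_lt.
have bm_gt0 : 0 < bitmask (e :: rest) by rewrite bitmask_cons addn_gt0 expn_gt0.
split; first by rewrite E13 dE -lt0n.
apply: hoare_hsem => //.
have low := lowest_bit udr ltdr ltrest.
have pcE := popcount_bitmask udr ltdr.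
have szr : size (e :: rest) <= n.
  rewrite -dE size_drop; apply: leq_trans (leq_subr _ _) _.
  by rewrite size_avail // leq_subr.
(* Both summands are below [2 ^ n], and [n < w] leaves one more bit for their sum. *)
have lt_sum : e + size (e :: rest) < 2 ^ w.
  have lt2 : n < 2 ^ n by apply: ltn_expl.
  have le2 : 2 ^ n.+1 <= 2 ^ w by rewrite leq_exp2l // n_lt_w.
  apply: leq_trans le2; rewrite expnS mul2n -addnn -addSn.
  by apply: leq_add; [exact: leq_trans lt_e (ltnW lt2) | exact: leq_trans szr (ltnW lt2)].
have wew : is_word n (e :: u).
  by move: uw => /andP[uu au]; rewrite /is_word /= ne uu lt_e.
have lt_cy : c + y < size L.
  apply: leq_trans (created_le n i.+1); rewrite createdS //.
  by rewrite ltn_add2l.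
have wE : word (c + y) = e :: u by apply: nth_created.
have avE : bitmask av = 2 ^ e + bitmask (avail n (e :: u)).
  rewrite -bitmask_cons; apply: bitmask_perm; apply: uniq_perm.
  - exact: avail_uniq.
  - by rewrite /= avail_uniq mem_avail inE eqxx andbF.
  move=> a; rewrite inE !mem_avail inE negb_or.
  by case: eqP => [->|_] //=; rewrite lt_e ne.
have c_gt0 : 0 < c by [].
rewrite /spawn_body; hstep E1; hstep E2; hstep E3; hstep E4; hstep E5; hstep E6;
  hstep E7; hstep E8; hstep E9; hstep E10; hstep E11; hstep F12; hstep F13;
  hstep F14; hstep F15; hstep F16.
rewrite E13 So dE evalSub // in E1; rewrite E1 in E2.
rewrite E2 So evalAdd low ?pcE // in E3.
rewrite E13 dE pcE in E4; rewrite E3 E4 evalSub ?leq_addl // addnK in E5.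
rewrite So E5 evalShl // in E6.
rewrite E13 dE E6 evalSub ?lt_bm // in E7; last by rewrite bitmask_cons leq_addr.
rewrite bitmask_cons addKn in E7.
have {}E8 j : j < D -> g j = block b w j e.
  by move=> lt_j; rewrite (proj1 E8) // keyval_scal /= E5 bt.
have lt_enc j : j < D -> enc b w j (e :: u) < 2 ^ w.
  by move=> lt_j; apply: (enc_lt fits lt_j wew).
have {}E9 j : j < D -> g0 j = (size u).+1 * block b w j e.
  move=> lt_j; rewrite E9 // lt_j E8 // E22 evalMul mulnC //.
  by apply: leq_ltn_trans (lt_enc j lt_j); rewrite leq_addr.
have {}E10 j : j < D -> g1 j = enc b w j (e :: u).
  move=> lt_j; rewrite E10 // lt_j v0 // E9 // evalAdd addnC // -?[(_ + _)]/(enc b w j (e :: u)) //.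
  exact: lt_enc.
rewrite keyval_vect (@vec_hkey _ 6 (e :: u)) in E11; last first.
  by move=> j lt_j /=; rewrite lt_j; apply: E10.
rewrite E12 E6 avE evalSub ?leq_addr // ?addKn in F12; last first.
  by rewrite -avE bitmask_lt ?avail_uniq //; apply/allP => a /lt_avail.
rewrite keyval_vect (@vec_hkey _ 6 (e :: u)) in F13; last first.
  by move=> j lt_j /=; rewrite lt_j; apply: E10.
rewrite keyval_vect (@vec_hkey _ 1 (word (c + y).-1)) // in F14.
have {}F15 j : j < D -> g2 j = enc b w j (e :: u).
  by move=> lt_j; rewrite F15 // lt_j evalAnd E10.
split; split.
- by [].
- move=> j a lt_j lt_a; rewrite /= tupd_tab ?odd_block_tab //; exact: bt.
- move=> m; rewrite /= tupd_tab //; exact: rt.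
- case: qt => q1 q2 q3 q4 q5; rewrite addnS; split=> [m|m|m j lt_m lt_j|m lt_m|m y' lt_m le_y'].
  + rewrite ltnS leq_eqVlt /= tupd_tab //= => /orP[/eqP->|lt_m].
      by rewrite wE E11 eqxx E5.
    rewrite ifN ?q1 // E11 -wE hkey_word ?(ltn_eqF lt_m) //; exact: ltn_trans lt_m lt_cy.
  + rewrite ltnS leq_eqVlt /= tupd_tab //= => /orP[/eqP->|lt_m].
      by rewrite wE F13 eqxx F12.
    rewrite ifN ?q2 // F13 -wE hkey_word ?(ltn_eqF lt_m) //; exact: ltn_trans lt_m lt_cy.
  + have lt_c1 : (c + y).-1 < size L by apply: leq_ltn_trans (leq_pred _) lt_cy.
    have cyE : (c + y).-1.+1 = c + y by rewrite prednK // addn_gt0 c_gt0.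
    case: (m =P (c + y).-1) => [->|/eqP nem].
      by rewrite cyE ltnSn wE -F14 [ta _]/= tupd_same // /= lt_j E10.
    rewrite [ta _]/= tupd_key; last by rewrite F14 hkey_word.
    rewrite [upd _ _ _ _]/= q3 // ltnS [m.+1 <= c + y]leq_eqVlt -[in m.+1 == c + y]cyE eqSS (negPf nem).
    by [].
  + by rewrite /= tupd_tab //= q4.
  + by rewrite /= tupd_tab //= q5.
- by [].
- exact: E7.
- by [].
- by [].
by rewrite addnS succnK wE => j lt_j; rewrite [LHS]/= lt_j F15.
Qed.

(** By [created_gt] a successor exists exactly while words remain, so the flag of the lookup can
    serve as the guard of the main loop. *)
Lemma advance_next s : spawn_inv (size av) s ->
  hoare D w advance s (hsize D advance) (main_inv i.+1).
Proof.
move=> [[[Sn Sk So Ss Sm] bt rt qt] [E12 E13 E22 v0 v1]].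
apply: hoare_hsem => //.
have cS : c + size av = created n i.+1 by rewrite createdS.
rewrite cS in qt v1.
have ltE : (i.+1 < created n i.+1) = (i.+1 < size L).
  apply/idP/idP => [lt|/created_gt//]; exact: leq_trans lt (created_le _ _).
rewrite /advance; hstep E1; hstep E2; hstep E3.
rewrite keyval_vect (vec_hkey v0) in E1; case: E1 => E1 Ex.
have Dl : D.-1 < D by rewrite prednK.
rewrite (queue_next qt) // ltE in Ex.
split; split=> //=.
- by rewrite Ex; case: ifP.
by move=> lt j lt_j; rewrite /= lt_j E2 // lt_j evalAnd E1 // (queue_next qt) // ltE lt.
Qed.

Definition body_cost : nat :=
  hsize D scan_init + ((\sum_(y < (depth u).+1) (hsize D scan_body).+1 + 1) +
    (hsize D spawn_init + ((\sum_(y < size av) (hsize D spawn_body).+1 + 1) +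
      hsize D advance))).

Lemma main_step s : main_inv i s ->
  sc s 14 != 0 /\ hoare D w main_body s body_cost (main_inv i.+1).
Proof.
move=> I; split; first by case: I => _ [-> _ _]; rewrite lt_i.
apply: hoare_seq; apply: hoare_conseq (scan_start I) (leqnn _) _ => s1 I1.
apply: hoare_seq.
apply: (hoare_conseq (hoare_while (B := fun=> hsize D scan_body)
  (N := (depth u).+1) _ _ _ I1)) => //.
- by move=> y s'; apply: scan_step.
- by move=> s' [_]; rewrite ltnn => -[].
move=> s2 I2; apply: hoare_seq; apply: hoare_conseq (spawn_start I2) (leqnn _) _ => s3 I3.
apply: hoare_seq.
apply: (hoare_conseq (hoare_while (B := fun=> hsize D spawn_body)
  (N := size av) _ _ _ I3)) => //.
- by move=> y s'; apply: spawn_step.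
- by move=> s' [_ [_ -> _ _ _]]; rewrite drop_size /bitmask big_nil.
by move=> s4 I4; apply: advance_next.
Qed.

End Scan.

(** * Total running time *)

Lemma sum_word (F : seq nat -> nat) : \sum_(x < size L) F (word x) = \sum_(v <- L) F v.
Proof. by rewrite (big_nth [::]) big_mkord. Qed.

Lemma sum_depth : \sum_(x < size L) (depth (word x)).+1 <= 4 * size L.
Proof.
rewrite (sum_word (fun v => (depth v).+1)) /L /words big_flatten big_map size_flatten /shape -map_comp sumnE big_map.
by rewrite big_distrr /=; apply: leq_sum => m _; apply: sum_mdepth.
Qed.

(** Every word except the empty one is created exactly once, as a child of another word. *)
Lemma sum_avail : \sum_(x < size L) size (avail n (word x)) < size L.
Proof.
suff H m : m <= size L -> created n m = (\sum_(x < m) size (avail n (word x))).+1.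
  by rewrite -H // created_total.
elim: m => [|m IH] le_m; first by rewrite big_ord0 /created take0.
by rewrite createdS // IH ?(ltnW le_m) // big_ord_recr.
Qed.

Definition block_cost : nat := hsize D block_index + (3 * D + 2 + hsize D block_store).

Definition word_cost : nat :=
  hsize D scan_init + hsize D spawn_init + hsize D advance +
  4 * (hsize D scan_body).+1 + (hsize D spawn_body).+1 + 3.

Definition time_constant : nat :=
  hsize D init_scalars + block_cost.+2 + 2 * pattern_cost + hsize D queue_init +
  (3 * word_cost + 1).

(** All scans together make at most four rounds per word on average, all expansions fewer rounds
    than there are words, and there are at most [3 * n!] words. The final [n!] absorbs the last test
    of the guard. *)
Lemma main_cost : \sum_(x < size L) (body_cost x).+1 + 1 <= (3 * word_cost + 1) * n`!.
Proof.
have sumE : \sum_(x < size L) (body_cost x).+1 =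
  size L * (hsize D scan_init + hsize D spawn_init + hsize D advance + 3) +
  (\sum_(x < size L) (depth (word x)).+1) * (hsize D scan_body).+1 +
  (\sum_(x < size L) size (avail n (word x))) * (hsize D spawn_body).+1.
  set K := _ + 3; have -> : size L * K = \sum_(x < size L) K.
    by rewrite sum_nat_const card_ord.
  rewrite !big_distrl /= -!big_split /=; apply: eq_bigr => x _.
  rewrite /body_cost /K !sum_nat_const !card_ord.
  move: (_ * _) (_ * _) (hsize D scan_init) (hsize D spawn_init) (hsize D advance).
  by move=> a1 a2 a3 a4 a5; lia.
have f_gt0 := fact_gt0 n; have le_l := size_words_le n; rewrite -/L in le_l.
have lt2 := sum_avail; have le1 := sum_depth; rewrite sumE /word_cost {sumE}.
move: (\sum_(x < size L) (depth (word x)).+1) (\sum_(x < size L) size (avail n (word x)))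
  le1 lt2 => S1 S2 le1 lt2.
move: (size L) (n`!) f_gt0 le_l le1 lt2 => l f f_gt0 le_l le1 lt2.
move: (hsize D scan_init + hsize D spawn_init + hsize D advance) => A.
move: (hsize D scan_body).+1 (hsize D spawn_body).+1 => B C.
have H1 : S1 * B <= 4 * l * B by rewrite leq_mul2r le1 orbT.
have H2 : S2 * C <= l * C by rewrite leq_mul2r (ltnW lt2) orbT.
apply: (@leq_trans (l * (A + 4 * B + C + 3) + f)).
  clear -H1 H2 f_gt0; nia.
by rewrite mulnDl mul1n leq_add2r mulnAC leq_mul2r le_l orbT.
Qed.

Lemma program_correct :
  exists T s, [/\ exec w (comp D hits_program) (input_state p X n b w) T s,
    outputs_hits D p X n b w s & T <= time_constant * n`!].
Proof.
have H : hoare D w hits_program start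
    (hsize D init_scalars + ((\sum_(a < n) block_cost.+1 + 1) + (pattern_cost * n.+1 +
      (hsize D queue_init + (\sum_(x < size L) (body_cost x).+1 + 1)))))
    (main_inv (size L)).
  apply: hoare_seq; apply: hoare_hsem => //.
  apply: hoare_seq; apply: (hoare_conseq (hoare_while (B := fun=> block_cost)
    (N := n) _ _ _ init_scalars_inv)) => //.
  - by move=> a s lt_a; apply: block_step.
  - by move=> s [[_ _ _ _ ->] _]; rewrite ltnn.
  move=> s1 I1; apply: hoare_seq.
  apply: hoare_conseq (pattern_ready I1) (leqnn _) _ => s2 I2.
  apply: hoare_seq; apply: hoare_conseq (queue_ready I2) (leqnn _) _ => s3 I3.
  apply: (hoare_while (B := body_cost)) I3 => //.
  - by move=> x s lt_x; apply: main_step.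
  - by move=> s [_ [-> _ _]]; rewrite ltnn.
have [s [T leT E] [[_ _ _ qt] _]] := H.
exists T, (conc s); split; first by rewrite -conc_start.
  move=> t; rewrite -key_inv_word.
  have wt := inv_word_is_word t.
  have lt_x : index (inv_word t) L < size L by rewrite index_mem mem_words.
  have := queue_hits qt lt_x; rewrite word_index // => /= ->; congr Some.
  rewrite (@hits_count_hits k n p X t rk) // => le_k m lt_m.
  by rewrite /rk le_k lt_m.
apply: leq_trans leT _; have := main_cost.
rewrite sum_nat_const card_ord.
have f_gt0 := fact_gt0 n.
have n_le : n <= n`! by apply: fact_geq.
move: (\sum_(_ < _) _) => S leS; rewrite /time_constant.
move: (3 * word_cost + 1) (hsize D init_scalars) (block_cost) (pattern_cost)
  (hsize D queue_init) leS => A B1 B2 B3 B4 leS.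
have H1 : n * B2.+1 + 1 <= B2.+2 * n`! by nia.
have H2 : B3 * n.+1 <= 2 * B3 * n`! by nia.
have H3 : B1 <= B1 * n`! by rewrite leq_pmulr.
have H4 : B4 <= B4 * n`! by rewrite leq_pmulr.
by clear -leS H1 H2 H3 H4; rewrite !mulnDl; lia.
Qed.

End Verification.

(** The encoding is injective and table 0 is initially empty, so all [n!] output keys are new in the
    sense of [exec_new_keys]. *)
Lemma time_lower_bound D k (p : 'S_k) (X : {set 'I_k.+1}) n b w c T s :
  perm_fits D n b w -> exec w c (input_state p X n b w) T s ->
  outputs_hits D p X n b w s -> n`! <= T.
Proof.
move=> fits E out.
pose ks := [seq encode_perm D b w t | t <- enum {perm 'I_n}].
have uks : uniq ks.
  by rewrite map_inj_uniq ?enum_uniq //; apply: encode_perm_inj.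
have := exec_new_keys E uks.
rewrite (@eq_in_count _ _ xpredT) => [|key /mapP[t _ ->]]; last by rewrite /= out.
rewrite count_predT size_map -cardE => le_T; apply: leq_trans le_T.
by rewrite -[leqLHS]card_Sn; apply: subset_leq_card; apply/subsetP.
Qed.

Theorem theorem9p4 (D : nat) (D_gt0 : 0 < D) :
  exists (prog : cmd) (c C : nat), 0 < c /\ 0 < C /\
    forall (k : nat) (p : 'S_k) (X : {set 'I_k.+1}) (n b w : nat),
      perm_fits D n b w -> size (input_mem p X) <= 2 ^ w ->
      exists (T : nat) (s : state),
        exec w prog (input_state p X n b w) T s /\
        outputs_hits D p X n b w s /\
        n`! <= c * T /\ T <= C * n`!.
Proof.
exists (comp D hits_program), 1, (time_constant D); split=> //; split.
  by rewrite /time_constant addnA addn1.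
move=> k p X n b w fits mem_fits.
have [T [s [E out leT]]] := program_correct D_gt0 fits mem_fits.
exists T, s; do 3!split=> //.
by rewrite mul1n; apply: time_lower_bound fits E out.
Qed.
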